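(* Consider an iterated span $\underline J=(A_0\xleftarrow{p_1}J_1\xrightarrow{q_1}\cdots\xleftarrow{p_n}J_n\xrightarrow{q_n}A_n)$ ($n\ge1$) of (locally discrete) split two-sided $2$-fibrations, a locally discrete split two-sided $2$-fibration $C\xleftarrow{p}K\xrightarrow{q}D$ and $2$-functors $f\colon A_0\to C$, $g\colon A_n\to D$. Any $2$-functor $\phi\colon J_1\times_{A_1}\cdots\times_{A_{n-1}}J_n\to K$ over $f$ and $g$ satisfies: (poc) $\phi(\lambda_{p_1}(s_1,\alpha),\mathrm{id}_{s_2},\dots,\mathrm{id}_{s_n})=\lambda_p(\phi(s_1,\dots,s_n),f\alpha)$ for any morphism $(s_1,\dots,s_n)$ of $\prod\underline J$ and $\alpha\colon p_1s_1\Rightarrow u$ in $A_0$; (iec) for any $1\le m<n$, morphisms $(s_1,\dots,s_m)$ in $\prod(J_1,\dots,J_m)$ and $(s_{m+1},\dots,s_n)$ in $\prod(J_{m+1},\dots,J_n)$, and $\alpha\colon p_{m+1}s_{m+1}\Rightarrow q_ms_m$ in $A_m$, the cell $\phi(\mathrm{id}_{s_1},\dots,\mathrm{id}_{s_{m-1}},\rho_{q_m}(\alpha,s_m),\lambda_{p_{m+1}}(s_{m+1},\alpha),\mathrm{id}_{s_{m+2}},\dots,\mathrm{id}_{s_n})$ is an identity cell; (pcc) $\phi(\mathrm{id}_{s_1},\dots,\mathrm{id}_{s_{n-1}},\rho_{q_n}(\beta,s_n))=\rho_q(g\beta,\phi(s_1,\dots,s_n))$ for any morphism $(s_1,\dots,s_n)$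 of $\prod\underline J$ and $\beta\colon u\Rightarrow q_ns_n$ in $A_n$. Moreover unary cells $\phi\colon(J_1,\dots,J_n)\Rightarrow K$ along $f$ and $g$ of $\mathsf{SpTwo2Fib}$ (respectively $\mathsf{SpTwo2Fib}_{\mathrm{ld}}$) correspond precisely to those $2$-functors $\phi\colon J_1\times_{A_1}\cdots\times_{A_{n-1}}J_n\to K$ (over $f$ and $g$) that satisfy the following additional conditions: (pcm) $\phi(\lambda_{p_1}(u,i_1),\mathrm{id}_{i_2},\dots,\mathrm{id}_{i_n})=\lambda_p(fu,\phi(i_1,\dots,i_n))$ for any object $(i_1,\dots,i_n)$ of $\prod\underline J$ and $u\colon a\to p_1i_1$ in $A_0$; (iem) for any $1\le m<n$, objects $(i_1,\dots,i_m)$ in $\prod(J_1,\dots,J_m)$ and $(i_{m+1},\dots,i_n)$ in $\prod(J_{m+1},\dots,J_n)$, and $u\colon q_mi_m\to p_{m+1}i_{m+1}$ in $A_m$, the morphism $\phi(\mathrm{id}_{i_1},\dots,\mathrm{id}_{i_{m-1}},\rho_{q_m}(i_m,u),\lambda_{p_{m+1}}(u,i_{m+1}),\mathrm{id}_{i_{m+2}},\dots,\mathrm{id}_{i_n})$ is an identity morphism; (pom) $\phi(\mathrm{id}_{i_1},\dots,\mathrm{id}_{i_{n-1}},\rho_{q_n}(i_n,v))=\rho_q(\phi(i_1,\dots,i_n),gv)$ for any object $(i_1,\dots,i_n)$ of $\prod\underline J$ and $v\colon q_ni_n\to b$ in $A_n$.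
   Context: All $2$-categories are large. $\odot$ denotes composition of cells along a morphism, in diagrammatic order; $\circ$ denotes composition of morphisms, horizontal composition and whiskering. All pullbacks are strict. **Lax arrow $2$-category.** $A^{\mathbf 2}$ has objects $(a,u,b)$ with $u\colon a\to b$; morphisms $(s,\zeta,t)\colon(a_0,u_0,b_0)\to(a_1,u_1,b_1)$ with $s\colon a_0\to a_1$, $t\colon b_0\to b_1$, $\zeta\colon t\circ u_0\Rightarrow u_1\circ s$; cells $(\sigma\colon s_0\Rightarrow s_1,\tau\colon t_0\Rightarrow t_1)$ with $\zeta_0\odot(u_1\circ\sigma)=(\tau\circ u_0)\odot\zeta_1$; projections $\mathrm{src},\mathrm{tgt}\colon A^{\mathbf 2}\to A$. Unit $\tilde\alpha\colon A\to A^{\mathbf 2}$: $a\mapsto(a,\mathrm{id}_a,a)$, $s\mapsto(s,\mathrm{id}_s,s)$, $\sigma\mapsto(\sigma,\sigma)$. Composition $\bar\alpha\colon A^{\mathbf 2}\times_AA^{\mathbf 2}\to A^{\mathbf 2}$: $(a,u,b,v,c)\mapsto(a,v\circ u,c)$, $(r,\zeta,s,\eta,t)\mapsto(r,(\eta\circ u_0)\odot(v_1\circ\zeta),t)$, $(\rho,\sigma,\tau)\mapsto(\rho,\tau)$. A $2$-functor $f\colon A\to C$ induces $f^{\mathbf 2}\colon A^{\mathbf 2}\to C^{\mathbf 2}$ entrywise. **Split two-sided $2$-fibrations.** A split two-sided $2$-fibration $J\colon A\nrightarrow B$ is a span $A\xleftarrow{p}J\xrightarrow{q}B$ of $2$-functors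 with $2$-functors $\lambda\colon A^{\mathbf 2}\times_AJ\to J$ (pullback of $\mathrm{tgt}$ and $p$) and $\rho\colon J\times_BB^{\mathbf 2}\to J$ (pullback of $q$ and $\mathrm{src}$) such that $p\lambda(x,i)=\mathrm{src}\,x$, $q\lambda(x,i)=qi$, $p\rho(i,y)=pi$, $q\rho(i,y)=\mathrm{tgt}\,y$ (on objects, morphisms and cells), $\lambda\circ(\bar\alpha\times\mathrm{id})=\lambda\circ(\mathrm{id}\times\lambda)$, $\lambda\circ(\tilde\alpha p,\mathrm{id}_J)=\mathrm{id}_J$, $\rho\circ(\mathrm{id}\times\bar\beta)=\rho\circ(\rho\times\mathrm{id})$, $\rho\circ(\mathrm{id}_J,\tilde\beta q)=\mathrm{id}_J$, $\rho\circ(\lambda\times\mathrm{id})=\lambda\circ(\mathrm{id}\times\rho)$. Associated cleavages ($\lambda_p$ for $p$, $\rho_q$ for $q$): for $v\colon qi\to b$, $v_!i:=\rho(i,(qi,v,b))$ and $\rho_q(i,v):=\rho(\mathrm{id}_i,(\mathrm{id}_{qi},\mathrm{id}_v,v))\colon i\to v_!i$; for $s\colon i\to j$ in $J$ and $\beta\colon u\Rightarrow qs$, $\beta^*s:=\rho(s,(qs,\beta,u))\colon i\to j$ and $\rho_q(\beta,s):=\rho(\mathrm{id}_s,(\mathrm{id}_{qs},\beta))\colon\beta^*s\Rightarrow s$; for $u\colon a\to pi$, $u^*i:=\lambda((a,u,pi),i)$ and $\lambda_p(u,i):=\lambda((u,\mathrm{id}_u,\mathrm{id}_{pi}),\mathrm{id}_i)\colon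 u^*i\to i$; for $\alpha\colon ps\Rightarrow v$, $\alpha_!s:=\lambda((v,\alpha,ps),s)$ and $\lambda_p(s,\alpha):=\lambda((\alpha,\mathrm{id}_{ps}),\mathrm{id}_s)\colon s\Rightarrow\alpha_!s$. $J$ is locally discrete if every cell $\sigma$ of $J$ with $p\sigma$ and $q\sigma$ identity cells is an identity cell. **Unary cells.** $\prod\underline J:=J_1\times_{A_1}\cdots\times_{A_{n-1}}J_n$, and likewise for subpaths. A unary cell $(J_1,\dots,J_n)\Rightarrow K$ along $f,g$ in $\mathsf{SpTwo2Fib}$ ($n\ge1$) is a $2$-functor $\phi\colon\prod\underline J\to K$ over $f$ and $g$ (i.e. $p\phi=fp_1\pi_{J_1}$, $q\phi=gq_n\pi_{J_n}$) satisfying the equivariance axioms, as equalities of $2$-functors: $\phi(\lambda(x,i_1),i_2,\dots,i_n)=\lambda_K(f^{\mathbf 2}x,\phi(i_1,\dots,i_n))$ on $A_0^{\mathbf 2}\times_{A_0}\prod\underline J$; $\phi(i_1,\dots,i_{n-1},\rho(i_n,y))=\rho_K(\phi(i_1,\dots,i_n),g^{\mathbf 2}y)$ on $\prod\underline J\times_{A_n}A_n^{\mathbf 2}$; and for $1\le m<n$, $\phi(\dots,\rho(i_m,x),i_{m+1},\dots)=\phi(\dots,i_m,\lambda(x,i_{m+1}),\dots)$ on $\prod(J_1,\dots,J_m)\times_{A_m}A_m^{\mathbf 2}\times_{A_m}\prod(J_{m+1},\dots,J_n)$. $\mathsf{SpTwo2Fib}_{\mathrm{ld}}\subset\mathsf{SpTwo2Fib}$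 restricts the horizontal morphisms to the locally discrete split two-sided $2$-fibrations, keeping all cells between them. *)

(* Defs.v *)
From Stdlib Require Import ssreflect ProofIrrelevance ClassicalEpsilon.

Set Implicit Arguments.
Unset Strict Implicit.
Unset Printing Implicit Defensive.

(** * Strict 2-categories

  Strict pullbacks and equalities between 2-functors compare morphisms and
  cells with different endpoints, so 2-categories are given in
  "source/target" style: one type for each of the objects, morphisms and cells,
  with compositions defined on composable pairs.  Compositions take a proof of
  composability; the laws hold for all choices of these proofs (which are
  irrelevant, and always derivable where they appear in a law). *)

Variant dim := Ob | Mor | Cel.

Record twocat := TwoCat {
  elt :> dim -> Type;
  src1 : elt Mor -> elt Ob;
  tgt1 : elt Mor -> elt Ob;
  src2 : elt Cel -> elt Mor;
  tgt2 : elt Cel -> elt Mor;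
  id1 : elt Ob -> elt Mor;
  id2 : elt Mor -> elt Cel;
  (* [comp t s] is t after s *)
  comp : forall t s : elt Mor, src1 t = tgt1 s -> elt Mor;
  (* [hcomp ta sa] is the horizontal composite, ta after sa *)
  hcomp : forall ta sa : elt Cel, src1 (src2 ta) = tgt1 (src2 sa) -> elt Cel;
  (* [vcomp sa ta] is composition along a morphism, in diagrammatic order *)
  vcomp : forall sa ta : elt Cel, tgt2 sa = src2 ta -> elt Cel;

  src1_tgt2 : forall x, src1 (tgt2 x) = src1 (src2 x);
  tgt1_tgt2 : forall x, tgt1 (tgt2 x) = tgt1 (src2 x);
  src1_id1 : forall a, src1 (id1 a) = a;
  tgt1_id1 : forall a, tgt1 (id1 a) = a;
  src2_id2 : forall s, src2 (id2 s) = s;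
  tgt2_id2 : forall s, tgt2 (id2 s) = s;
  src1_comp : forall t s e, src1 (@comp t s e) = src1 s;
  tgt1_comp : forall t s e, tgt1 (@comp t s e) = tgt1 t;
  src2_hcomp : forall ta sa e e',
    src2 (@hcomp ta sa e) = @comp (src2 ta) (src2 sa) e';
  tgt2_hcomp : forall ta sa e e',
    tgt2 (@hcomp ta sa e) = @comp (tgt2 ta) (tgt2 sa) e';
  src2_vcomp : forall sa ta e, src2 (@vcomp sa ta e) = src2 sa;
  tgt2_vcomp : forall sa ta e, tgt2 (@vcomp sa ta e) = tgt2 ta;

  comp_idl : forall s e, @comp (id1 (tgt1 s)) s e = s;
  comp_idr : forall s e, @comp s (id1 (src1 s)) e = s;
  comp_assoc : forall u t s e1 e2 e3 e4,
    @comp (@comp u t e1) s e2 = @comp u (@comp t s e3) e4;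
  vcomp_idl : forall x e, @vcomp (id2 (src2 x)) x e = x;
  vcomp_idr : forall x e, @vcomp x (id2 (tgt2 x)) e = x;
  vcomp_assoc : forall x y z e1 e2 e3 e4,
    @vcomp (@vcomp x y e1) z e2 = @vcomp x (@vcomp y z e3) e4;
  hcomp_idl : forall x e, @hcomp (id2 (id1 (tgt1 (src2 x)))) x e = x;
  hcomp_idr : forall x e, @hcomp x (id2 (id1 (src1 (src2 x)))) e = x;
  hcomp_assoc : forall x y z e1 e2 e3 e4,
    @hcomp (@hcomp x y e1) z e2 = @hcomp x (@hcomp y z e3) e4;
  hcomp_id2 : forall t s e e', @hcomp (id2 t) (id2 s) e = id2 (@comp t s e');
  interchange : forall x x' y y' e1 e2 e3 e4 e5 e6,
    @hcomp (@vcomp x x' e1) (@vcomp y y' e2) e3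
    = @vcomp (@hcomp x y e4) (@hcomp x' y' e5) e6
}.

Arguments src1 {C} s : rename.
Arguments tgt1 {C} s : rename.
Arguments src2 {C} x : rename.
Arguments tgt2 {C} x : rename.
Arguments id1 {C} a : rename.
Arguments id2 {C} s : rename.
Arguments comp {C t s} e : rename.
Arguments hcomp {C ta sa} e : rename.
Arguments vcomp {C sa ta} e : rename.

Definition is_id1 (C : twocat) (s : C Mor) : Prop := exists a, s = id1 a.
Definition is_id2 (C : twocat) (x : C Cel) : Prop := exists s, x = id2 s.

(** * 2-functors *)

Record functor (C D : twocat) := Functor {
  fmap :> forall d, C d -> D d;
  f_src1 : forall s, @fmap Ob (src1 s) = src1 (@fmap Mor s);
  f_tgt1 : forall s, @fmap Ob (tgt1 s) = tgt1 (@fmap Mor s);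
  f_src2 : forall x, @fmap Mor (src2 x) = src2 (@fmap Cel x);
  f_tgt2 : forall x, @fmap Mor (tgt2 x) = tgt2 (@fmap Cel x);
  f_id1 : forall a, @fmap Mor (id1 a) = id1 (@fmap Ob a);
  f_id2 : forall s, @fmap Cel (id2 s) = id2 (@fmap Mor s);
  f_comp : forall t s e e',
    @fmap Mor (@comp C t s e) = @comp D (@fmap Mor t) (@fmap Mor s) e';
  f_hcomp : forall x y e e',
    @fmap Cel (@hcomp C x y e) = @hcomp D (@fmap Cel x) (@fmap Cel y) e';
  f_vcomp : forall x y e e',
    @fmap Cel (@vcomp C x y e) = @vcomp D (@fmap Cel x) (@fmap Cel y) e'
}.
Arguments fmap {C D} f d _ : rename.
Arguments f_comp {C D} f {t s} e e' : rename.
Arguments f_hcomp {C D} f {x y} e e' : rename.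
Arguments f_vcomp {C D} f {x y} e e' : rename.

(** Congruence of the partial compositions, by proof irrelevance. *)

Lemma comp_eq (C : twocat) (t t' s s' : C Mor) e e' :
  t = t' -> s = s' -> @comp C t s e = @comp C t' s' e'.
Proof. by move=> h1 h2; subst; rewrite (proof_irrelevance _ e e'). Qed.

Lemma hcomp_eq (C : twocat) (t t' s s' : C Cel) e e' :
  t = t' -> s = s' -> @hcomp C t s e = @hcomp C t' s' e'.
Proof. by move=> h1 h2; subst; rewrite (proof_irrelevance _ e e'). Qed.

Lemma vcomp_eq (C : twocat) (t t' s s' : C Cel) e e' :
  t = t' -> s = s' -> @vcomp C t s e = @vcomp C t' s' e'.
Proof. by move=> h1 h2; subst; rewrite (proof_irrelevance _ e e'). Qed.

Definition fcompose (C D E : twocat) (G : functor D E) (F : functor C D) :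
  functor C E.
Proof.
refine {| fmap := fun d x => G d (F d x) |}; intros.
- by rewrite !f_src1.
- by rewrite !f_tgt1.
- by rewrite !f_src2.
- by rewrite !f_tgt2.
- by rewrite !f_id1.
- by rewrite !f_id2.
- unshelve erewrite (f_comp F); [by rewrite -f_src1 -f_tgt1 e|exact: f_comp].
- unshelve erewrite (f_hcomp F);
    [by rewrite -!f_src2 -f_src1 -f_tgt1 e|exact: f_hcomp].
- unshelve erewrite (f_vcomp F); [by rewrite -f_src2 -f_tgt2 e|exact: f_vcomp].
Defined.

(** * Strict pullbacks *)

Record pb (X Y Z : Type) (f : X -> Z) (g : Y -> Z) := Pb {
  pb1 : X;
  pb2 : Y;
  pbE : f pb1 = g pb2
}.
Arguments Pb {X Y Z f g} pb1 pb2 pbE.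

Lemma pb_eq (X Y Z : Type) (f : X -> Z) (g : Y -> Z) (z w : pb f g) :
  pb1 z = pb1 w -> pb2 z = pb2 w -> z = w.
Proof.
case: z => [x y e]; case: w => [x' y' e'] /= h1 h2; subst.
by rewrite (proof_irrelevance _ e e').
Qed.

Section Pullback.
Variables (X Y Z : twocat) (F : functor X Z) (G : functor Y Z).

Let pbt (d : dim) : Type := pb (F d) (G d).

Lemma pbt_src1 (s : pbt Mor) : F Ob (src1 (pb1 s)) = G Ob (src1 (pb2 s)).
Proof. by rewrite !f_src1 pbE. Qed.
Lemma pbt_tgt1 (s : pbt Mor) : F Ob (tgt1 (pb1 s)) = G Ob (tgt1 (pb2 s)).
Proof. by rewrite !f_tgt1 pbE. Qed.
Lemma pbt_src2 (s : pbt Cel) : F Mor (src2 (pb1 s)) = G Mor (src2 (pb2 s)).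
Proof. by rewrite !f_src2 pbE. Qed.
Lemma pbt_tgt2 (s : pbt Cel) : F Mor (tgt2 (pb1 s)) = G Mor (tgt2 (pb2 s)).
Proof. by rewrite !f_tgt2 pbE. Qed.
Lemma pbt_id1 (a : pbt Ob) : F Mor (id1 (pb1 a)) = G Mor (id1 (pb2 a)).
Proof. by rewrite !f_id1 pbE. Qed.
Lemma pbt_id2 (s : pbt Mor) : F Cel (id2 (pb1 s)) = G Cel (id2 (pb2 s)).
Proof. by rewrite !f_id2 pbE. Qed.

Definition pb_src1 (s : pbt Mor) : pbt Ob := Pb _ _ (pbt_src1 s).
Definition pb_tgt1 (s : pbt Mor) : pbt Ob := Pb _ _ (pbt_tgt1 s).
Definition pb_src2 (s : pbt Cel) : pbt Mor := Pb _ _ (pbt_src2 s).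
Definition pb_tgt2 (s : pbt Cel) : pbt Mor := Pb _ _ (pbt_tgt2 s).
Definition pb_id1 (a : pbt Ob) : pbt Mor := Pb _ _ (pbt_id1 a).
Definition pb_id2 (s : pbt Mor) : pbt Cel := Pb _ _ (pbt_id2 s).

Definition pbE1 d (z w : pbt d) (e : z = w) : pb1 z = pb1 w :=
  f_equal (@pb1 _ _ _ _ _) e.
Definition pbE2 d (z w : pbt d) (e : z = w) : pb2 z = pb2 w :=
  f_equal (@pb2 _ _ _ _ _) e.

Lemma pbt_comp (t s : pbt Mor) (e : pb_src1 t = pb_tgt1 s) :
  F Mor (comp (pbE1 e)) = G Mor (comp (pbE2 e)).
Proof.
move: (pbE1 e) (pbE2 e) => /= e1 e2.
unshelve erewrite (f_comp F); first by rewrite -f_src1 -f_tgt1 e1.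
unshelve erewrite (f_comp G); first by rewrite -f_src1 -f_tgt1 e2.
by apply: comp_eq; exact: pbE.
Qed.
Lemma pbt_hcomp (t s : pbt Cel) (e : pb_src1 (pb_src2 t) = pb_tgt1 (pb_src2 s)) :
  F Cel (hcomp (pbE1 e)) = G Cel (hcomp (pbE2 e)).
Proof.
move: (pbE1 e) (pbE2 e) => /= e1 e2.
unshelve erewrite (f_hcomp F); first by rewrite -!f_src2 -f_src1 -f_tgt1 e1.
unshelve erewrite (f_hcomp G); first by rewrite -!f_src2 -f_src1 -f_tgt1 e2.
by apply: hcomp_eq; exact: pbE.
Qed.
Lemma pbt_vcomp (t s : pbt Cel) (e : pb_tgt2 t = pb_src2 s) :
  F Cel (vcomp (pbE1 e)) = G Cel (vcomp (pbE2 e)).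
Proof.
move: (pbE1 e) (pbE2 e) => /= e1 e2.
unshelve erewrite (f_vcomp F); first by rewrite -f_src2 -f_tgt2 e1.
unshelve erewrite (f_vcomp G); first by rewrite -f_src2 -f_tgt2 e2.
by apply: vcomp_eq; exact: pbE.
Qed.

Definition pb_comp (t s : pbt Mor) (e : pb_src1 t = pb_tgt1 s) : pbt Mor :=
  Pb _ _ (pbt_comp e).
Definition pb_hcomp (t s : pbt Cel)
  (e : pb_src1 (pb_src2 t) = pb_tgt1 (pb_src2 s)) : pbt Cel :=
  Pb _ _ (pbt_hcomp e).
Definition pb_vcomp (t s : pbt Cel) (e : pb_tgt2 t = pb_src2 s) : pbt Cel :=
  Pb _ _ (pbt_vcomp e).

Definition pullback : twocat.
Proof.
refine (@TwoCat (fun d => pb (F d) (G d)) pb_src1 pb_tgt1 pb_src2 pb_tgt2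
  pb_id1 pb_id2 pb_comp pb_hcomp pb_vcomp
  _ _ _ _ _ _ _ _ _ _ _ _ _ _ _ _ _ _ _ _ _ _ _); intros; apply: pb_eq.
1-2: exact: src1_tgt2.
1-2: exact: tgt1_tgt2.
1-2: exact: src1_id1.
1-2: exact: tgt1_id1.
1-2: exact: src2_id2.
1-2: exact: tgt2_id2.
1-2: exact: src1_comp.
1-2: exact: tgt1_comp.
1-2: exact: src2_hcomp.
1-2: exact: tgt2_hcomp.
1-2: exact: src2_vcomp.
1-2: exact: tgt2_vcomp.
1-2: exact: comp_idl.
1-2: exact: comp_idr.
1-2: exact: comp_assoc.
1-2: exact: vcomp_idl.
1-2: exact: vcomp_idr.
1-2: exact: vcomp_assoc.
1-2: exact: hcomp_idl.
1-2: exact: hcomp_idr.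
1-2: exact: hcomp_assoc.
1-2: exact: hcomp_id2.
1-2: exact: interchange.
Defined.

Definition pr1 : functor (pullback) X.
Proof.
by refine {| fmap := fun d (z : pullback d) => pb1 z |}; intros;
   first [exact: comp_eq | exact: hcomp_eq | exact: vcomp_eq | idtac].
Defined.

Definition pr2 : functor (pullback) Y.
Proof.
by refine {| fmap := fun d (z : pullback d) => pb2 z |}; intros;
   first [exact: comp_eq | exact: hcomp_eq | exact: vcomp_eq | idtac].
Defined.

End Pullback.
(** * Total versions of the compositions, for calculations

  Composites of non-composable pairs take a dummy value.  They serve only to
  rewrite without carrying proofs of composability. *)

Section Total.
Variable C : twocat.

Definition tc (t s : C Mor) : C Mor :=
  match excluded_middle_informative (src1 t = tgt1 s) with
  | left e => comp e
  | right _ => t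
  end.
Definition th (x y : C Cel) : C Cel :=
  match excluded_middle_informative (src1 (src2 x) = tgt1 (src2 y)) with
  | left e => hcomp e
  | right _ => x
  end.
Definition tv (x y : C Cel) : C Cel :=
  match excluded_middle_informative (tgt2 x = src2 y) with
  | left e => vcomp e
  | right _ => x
  end.

Lemma compE (t s : C Mor) (e : src1 t = tgt1 s) : comp e = tc t s.
Proof. by rewrite /tc; case: excluded_middle_informative => // e'; exact: comp_eq. Qed.
Lemma hcompE (x y : C Cel) (e : src1 (src2 x) = tgt1 (src2 y)) : hcomp e = th x y.
Proof. by rewrite /th; case: excluded_middle_informative => // e'; exact: hcomp_eq. Qed.
Lemma vcompE (x y : C Cel) (e : tgt2 x = src2 y) : vcomp e = tv x y.
Proof. by rewrite /tv; case: excluded_middle_informative => // e'; exact: vcomp_eq. Qed.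

Lemma src1_tc (t s : C Mor) : src1 t = tgt1 s -> src1 (tc t s) = src1 s.
Proof. by move=> e; rewrite -(compE e) src1_comp. Qed.
Lemma tgt1_tc (t s : C Mor) : src1 t = tgt1 s -> tgt1 (tc t s) = tgt1 t.
Proof. by move=> e; rewrite -(compE e) tgt1_comp. Qed.
Lemma src2_th (x y : C Cel) : src1 (src2 x) = tgt1 (src2 y) ->
  src2 (th x y) = tc (src2 x) (src2 y).
Proof. by move=> e; rewrite -(hcompE e) -(compE e) -src2_hcomp. Qed.
Lemma tgt2_th (x y : C Cel) : src1 (src2 x) = tgt1 (src2 y) ->
  tgt2 (th x y) = tc (tgt2 x) (tgt2 y).
Proof.
move=> e; have e' : src1 (tgt2 x) = tgt1 (tgt2 y) by rewrite src1_tgt2 tgt1_tgt2.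
by rewrite -(hcompE e) -(compE e') -tgt2_hcomp.
Qed.
Lemma src2_tv (x y : C Cel) : tgt2 x = src2 y -> src2 (tv x y) = src2 x.
Proof. by move=> e; rewrite -(vcompE e) src2_vcomp. Qed.
Lemma tgt2_tv (x y : C Cel) : tgt2 x = src2 y -> tgt2 (tv x y) = tgt2 y.
Proof. by move=> e; rewrite -(vcompE e) tgt2_vcomp. Qed.

Lemma tc_idl (s : C Mor) a : a = tgt1 s -> tc (id1 a) s = s.
Proof. by move=> ->; unshelve erewrite <- compE; [exact: src1_id1|exact: comp_idl]. Qed.
Lemma tc_idr (s : C Mor) a : a = src1 s -> tc s (id1 a) = s.
Proof. by move=> ->; unshelve erewrite <- compE; [by rewrite tgt1_id1|exact: comp_idr]. Qed.
Lemma tc_assoc (u t s : C Mor) : src1 u = tgt1 t -> src1 t = tgt1 s ->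
  tc (tc u t) s = tc u (tc t s).
Proof.
move=> e1 e2; rewrite -(compE e1) -(compE e2).
unshelve erewrite <- compE; first by rewrite src1_comp.
unshelve erewrite <- compE; first by rewrite tgt1_comp.
exact: comp_assoc.
Qed.
Lemma tv_idl (x : C Cel) s : s = src2 x -> tv (id2 s) x = x.
Proof. by move=> ->; unshelve erewrite <- vcompE; [exact: tgt2_id2|exact: vcomp_idl]. Qed.
Lemma tv_idr (x : C Cel) s : s = tgt2 x -> tv x (id2 s) = x.
Proof. by move=> ->; unshelve erewrite <- vcompE; [by rewrite src2_id2|exact: vcomp_idr]. Qed.
Lemma tv_assoc (x y z : C Cel) : tgt2 x = src2 y -> tgt2 y = src2 z ->
  tv (tv x y) z = tv x (tv y z).
Proof.
move=> e1 e2; rewrite -(vcompE e1) -(vcompE e2).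
unshelve erewrite <- vcompE; first by rewrite tgt2_vcomp.
unshelve erewrite <- vcompE; first by rewrite src2_vcomp.
exact: vcomp_assoc.
Qed.
Lemma th_idl (x : C Cel) a : a = tgt1 (src2 x) -> th (id2 (id1 a)) x = x.
Proof.
by move=> ->; unshelve erewrite <- hcompE;
  [by rewrite src2_id2 src1_id1|exact: hcomp_idl].
Qed.
Lemma th_idr (x : C Cel) a : a = src1 (src2 x) -> th x (id2 (id1 a)) = x.
Proof.
by move=> ->; unshelve erewrite <- hcompE;
  [by rewrite src2_id2 tgt1_id1|exact: hcomp_idr].
Qed.
Lemma th_assoc (x y z : C Cel) :
  src1 (src2 x) = tgt1 (src2 y) -> src1 (src2 y) = tgt1 (src2 z) ->
  th (th x y) z = th x (th y z).
Proof.
move=> e1 e2; rewrite -(hcompE e1) -(hcompE e2).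
unshelve erewrite <- hcompE.
  by unshelve erewrite src2_hcomp; [exact: e1|rewrite src1_comp].
unshelve erewrite <- hcompE.
  by unshelve erewrite src2_hcomp; [exact: e2|rewrite tgt1_comp].
exact: hcomp_assoc.
Qed.
Lemma th_id2 (t s : C Mor) : src1 t = tgt1 s ->
  th (id2 t) (id2 s) = id2 (tc t s).
Proof.
move=> e; rewrite -(compE e); unshelve erewrite <- hcompE; first by rewrite !src2_id2.
exact: hcomp_id2.
Qed.
Lemma th_tv (x x' y y' : C Cel) : tgt2 x = src2 x' -> tgt2 y = src2 y' ->
  src1 (src2 x) = tgt1 (src2 y) ->
  th (tv x x') (tv y y') = tv (th x y) (th x' y').
Proof.
move=> e1 e2 e3.
have e4 : src1 (src2 x') = tgt1 (src2 y').
  by rewrite -e1 -e2 src1_tgt2 tgt1_tgt2.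
rewrite -(vcompE e1) -(vcompE e2) -(hcompE e3) -(hcompE e4).
unshelve erewrite <- hcompE; first by rewrite !src2_vcomp.
unshelve erewrite <- vcompE; last exact: interchange.
have e5 : src1 (tgt2 x) = tgt1 (tgt2 y) by rewrite src1_tgt2 tgt1_tgt2.
unshelve erewrite tgt2_hcomp; first exact: e5.
unshelve erewrite src2_hcomp; first exact: e4.
exact: comp_eq.
Qed.

Lemma th_wl (u : C Mor) (x y : C Cel) : src1 u = tgt1 (src2 x) ->
  tgt2 x = src2 y -> th (id2 u) (tv x y) = tv (th (id2 u) x) (th (id2 u) y).
Proof.
move=> e1 e2; rewrite -th_tv ?src2_id2 ?tgt2_id2 // tv_idl // src2_id2 //.
Qed.
Lemma th_wr (u : C Mor) (x y : C Cel) : src1 (src2 x) = tgt1 u ->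
  tgt2 x = src2 y -> th (tv x y) (id2 u) = tv (th x (id2 u)) (th y (id2 u)).
Proof.
move=> e1 e2; rewrite -th_tv ?src2_id2 ?tgt2_id2 // tv_idl // src2_id2 //.
Qed.

Lemma th_lr (x y : C Cel) : src1 (src2 x) = tgt1 (src2 y) ->
  tv (th x (id2 (src2 y))) (th (id2 (tgt2 x)) y)
  = tv (th (id2 (src2 x)) y) (th x (id2 (tgt2 y))).
Proof.
move=> e; rewrite -!th_tv ?tgt2_id2 ?src2_id2 //.
by rewrite !tv_idl // !tv_idr.
Qed.

End Total.

Ltac total :=
  repeat match goal with
  | |- context [@comp ?C ?x ?y ?e] =>
      rewrite (@compE C x y e)
  | |- context [@hcomp ?C ?x ?y ?e] =>
      rewrite (@hcompE C x y e)
  | |- context [@vcomp ?C ?x ?y ?e] =>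
      rewrite (@vcompE C x y e)
  end.

(* Normalizes sources and targets. *)
Ltac glob :=
  repeat match goal with H : src2 ?x = @comp _ _ _ _ |- _ => rewrite compE in H
         | H : tgt2 ?x = @comp _ _ _ _ |- _ => rewrite compE in H end;
  globr
with globr :=
  total;
  repeat first
  [ reflexivity
  | assumption
  | rewrite src1_tgt2 | rewrite tgt1_tgt2 | rewrite src1_id1 | rewrite tgt1_id1
  | rewrite src2_id2 | rewrite tgt2_id2
  | match goal with
    | H : src2 ?x = tc _ _ |- context [src2 ?x] => rewrite H
    | H : tgt2 ?x = tc _ _ |- context [tgt2 ?x] => rewrite H
    end
  | rewrite src1_tc; [|solve [globr]]
  | rewrite tgt1_tc; [|solve [globr]]
  | rewrite src2_th; [|solve [globr]]
  | rewrite tgt2_th; [|solve [globr]]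
  | rewrite src2_tv; [|solve [globr]]
  | rewrite tgt2_tv; [|solve [globr]]
  | rewrite tc_assoc; [|solve [globr]|solve [globr]] ];
  try solve [congruence].

(** * The lax arrow 2-category *)

(* A morphism (am_src, am_cell, am_tgt) from the object [am_dom] to the object
   [am_cod]; objects of the lax arrow 2-category of [A] are morphisms of [A]. *)
Record arr_mor (A : twocat) := ArrMor {
  am_dom : A Mor;
  am_cod : A Mor;
  am_src : A Mor;
  am_tgt : A Mor;
  am_cell : A Cel;
  am_src_src : src1 am_src = src1 am_dom;
  am_src_tgt : src1 am_cod = tgt1 am_src;
  am_tgt_src : src1 am_tgt = tgt1 am_dom;
  am_tgt_tgt : tgt1 am_tgt = tgt1 am_cod;
  am_cell_src : src2 am_cell = comp am_tgt_src;
  am_cell_tgt : tgt2 am_cell = comp am_src_tgt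
}.

(* A cell (ac_src, ac_tgt) between the parallel morphisms [ac_dom] and
   [ac_cod].  The equations between endpoints quantified over in [ac_law] are
   consequences of the preceding fields. *)
Record arr_cell (A : twocat) := ArrCell {
  ac_dom : arr_mor A;
  ac_cod : arr_mor A;
  ac_src : A Cel;
  ac_tgt : A Cel;
  ac_eq_dom : am_dom ac_cod = am_dom ac_dom;
  ac_eq_cod : am_cod ac_cod = am_cod ac_dom;
  ac_src_src : src2 ac_src = am_src ac_dom;
  ac_src_tgt : tgt2 ac_src = am_src ac_cod;
  ac_tgt_src : src2 ac_tgt = am_tgt ac_dom;
  ac_tgt_tgt : tgt2 ac_tgt = am_tgt ac_cod;
  ac_law : forall e1 e2 e3 e4,
    @vcomp A (am_cell ac_dom) (@hcomp A (id2 (am_cod ac_dom)) ac_src e1) e2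
    = @vcomp A (@hcomp A ac_tgt (id2 (am_dom ac_dom)) e3) (am_cell ac_cod) e4
}.

Ltac pirr :=
  repeat match goal with
  | H1 : ?P, H2 : ?P |- _ =>
      assert (H1 = H2) by apply proof_irrelevance; subst H2
  end.

Lemma arr_mor_eq (A : twocat) (x y : arr_mor A) :
  am_dom x = am_dom y -> am_cod x = am_cod y -> am_src x = am_src y ->
  am_tgt x = am_tgt y -> am_cell x = am_cell y -> x = y.
Proof.
case: x => [? ? ? ? ? ? ? ? ? ? ?]; case: y => [? ? ? ? ? ? ? ? ? ? ?] /=.
move=> ? ? ? ? ?; subst; by pirr.
Qed.

Lemma arr_cell_eq (A : twocat) (x y : arr_cell A) :
  ac_dom x = ac_dom y -> ac_cod x = ac_cod y -> ac_src x = ac_src y ->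
  ac_tgt x = ac_tgt y -> x = y.
Proof.
case: x => [? ? ? ? ? ? ? ? ? ? ?]; case: y => [? ? ? ? ? ? ? ? ? ? ?] /=.
move=> ? ? ? ?; subst; by pirr.
Qed.

Lemma am_cell_srcE (A : twocat) (x : arr_mor A) : src2 (am_cell x) = tc (am_tgt x) (am_dom x).
Proof. by rewrite -(compE (am_tgt_src x)) am_cell_src. Qed.
Lemma am_cell_tgtE (A : twocat) (x : arr_mor A) : tgt2 (am_cell x) = tc (am_cod x) (am_src x).
Proof. by rewrite -(compE (am_src_tgt x)) am_cell_tgt. Qed.

(* All equations satisfied by the components of a morphism, resp. a cell. *)
Ltac mfacts x :=
  have := am_src_src x; have := am_src_tgt x; have := am_tgt_src x;
  have := am_tgt_tgt x; have := am_cell_srcE x; have := am_cell_tgtE x.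

Ltac cfacts x :=
  have := ac_eq_dom x; have := ac_eq_cod x; have := ac_src_src x;
  have := ac_src_tgt x; have := ac_tgt_src x; have := ac_tgt_tgt x;
  mfacts (ac_dom x); mfacts (ac_cod x).

Ltac gl := try solve [glob].

(* Objects are the morphisms of [A]; a pair (s', z', t') after (s, z, t) composes
   to (s' s, (t' z) ; (z' s), t' t). *)
Section ArrowTwocat.
Variable A : twocat.

Definition arr_elt (d : dim) : Type :=
  match d with Ob => A Mor | Mor => arr_mor A | Cel => arr_cell A end.

Definition arr_id1 (u : A Mor) : arr_mor A.
Proof.
unshelve refine (@ArrMor A u u (id1 (src1 u)) (id1 (tgt1 u)) (id2 u) _ _ _ _ _ _).
all: by rewrite ?compE ?src1_id1 ?tgt1_id1 ?src2_id2 ?tgt2_id2 ?tc_idl ?tc_idr.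
Defined.

Section Comp.
Variables (x' x : arr_mor A) (e : am_dom x' = am_cod x).

Lemma am_comp_s : src1 (am_src x') = tgt1 (am_src x).
Proof. by rewrite am_src_src e am_src_tgt. Qed.
Lemma am_comp_t : src1 (am_tgt x') = tgt1 (am_tgt x).
Proof. by rewrite am_tgt_src e am_tgt_tgt. Qed.
Lemma am_comp_1 : src1 (src2 (id2 (am_tgt x'))) = tgt1 (src2 (am_cell x)).
Proof. by rewrite src2_id2 am_cell_src tgt1_comp am_comp_t. Qed.
Lemma am_comp_2 : src1 (src2 (am_cell x')) = tgt1 (src2 (id2 (am_src x))).
Proof. by rewrite src2_id2 am_cell_src src1_comp e am_src_tgt. Qed.
Lemma am_comp_3 : tgt2 (hcomp am_comp_1) = src2 (hcomp am_comp_2).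
Proof. move: e; mfacts x; mfacts x'; intros; glob. Qed.

Definition arr_comp1 : arr_mor A.
Proof.
unshelve refine (@ArrMor A (am_dom x) (am_cod x') (comp am_comp_s) (comp am_comp_t)
  (vcomp am_comp_3) _ _ _ _ _ _); clear -e;
move: e; mfacts x; mfacts x'; intros; glob.
Defined.
End Comp.

Lemma ac_lawE (x : arr_cell A) :
  tv (am_cell (ac_dom x)) (th (id2 (am_cod (ac_dom x))) (ac_src x))
  = tv (th (ac_tgt x) (id2 (am_dom (ac_dom x)))) (am_cell (ac_cod x)).
Proof.
have e1 : src1 (src2 (id2 (am_cod (ac_dom x)))) = tgt1 (src2 (ac_src x)).
  by cfacts x; intros; glob.
have e3 : src1 (src2 (ac_tgt x)) = tgt1 (src2 (id2 (am_dom (ac_dom x)))).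
  by cfacts x; intros; glob.
have e2 : tgt2 (am_cell (ac_dom x)) = src2 (hcomp e1).
  by cfacts x; intros; glob.
have e4 : tgt2 (hcomp e3) = src2 (am_cell (ac_cod x)).
  by cfacts x; intros; glob.
by move: (ac_law e2 e4); total.
Qed.

Definition arr_id2 (m : arr_mor A) : arr_cell A.
Proof.
unshelve refine (@ArrCell A m m (id2 (am_src m)) (id2 (am_tgt m)) _ _ _ _ _ _ _);
  try by rewrite ?src2_id2 ?tgt2_id2.
intros; total; mfacts m; intros.
rewrite !th_id2 ?tv_idl ?tv_idr //; glob.
Defined.

Section VComp.
Variables (x y : arr_cell A) (e : ac_cod x = ac_dom y).

Lemma ac_vcomp_s : tgt2 (ac_src x) = src2 (ac_src y).
Proof. by rewrite ac_src_tgt e ac_src_src. Qed.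
Lemma ac_vcomp_t : tgt2 (ac_tgt x) = src2 (ac_tgt y).
Proof. by rewrite ac_tgt_tgt e ac_tgt_src. Qed.

Definition arr_vcomp : arr_cell A.
Proof.
unshelve refine (@ArrCell A (ac_dom x) (ac_cod y) (vcomp ac_vcomp_s)
  (vcomp ac_vcomp_t) _ _ _ _ _ _ _).
- by rewrite ac_eq_dom -e ac_eq_dom.
- by rewrite ac_eq_cod -e ac_eq_cod.
- by rewrite src2_vcomp ac_src_src.
- by rewrite tgt2_vcomp ac_src_tgt.
- by rewrite src2_vcomp ac_tgt_src.
- by rewrite tgt2_vcomp ac_tgt_tgt.
- intros; total.
  move: (ac_lawE x) (ac_lawE y); rewrite -e => Lx Ly.
  have := ac_vcomp_s; have := ac_vcomp_t.
  cfacts x; cfacts y; rewrite -e; intros.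
  rewrite th_wl; gl. rewrite -tv_assoc; gl. rewrite Lx tv_assoc; gl. 
  have Ed := ac_eq_dom x; have Ec := ac_eq_cod x.
  rewrite -Ec Ly Ed -tv_assoc; gl.
  rewrite th_wr; gl.
Defined.
End VComp.

Section HComp.
Variables (x' x : arr_cell A) (e : am_dom (ac_dom x') = am_cod (ac_dom x)).

Lemma ac_hcomp_cod : am_dom (ac_cod x') = am_cod (ac_cod x).
Proof. by rewrite ac_eq_dom ac_eq_cod. Qed.
Lemma ac_hcomp_s : src1 (src2 (ac_src x')) = tgt1 (src2 (ac_src x)).
Proof. by rewrite !ac_src_src; exact: am_comp_s. Qed.
Lemma ac_hcomp_t : src1 (src2 (ac_tgt x')) = tgt1 (src2 (ac_tgt x)).
Proof. by rewrite !ac_tgt_src; exact: am_comp_t. Qed.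

Definition arr_hcomp : arr_cell A.
Proof.
unshelve refine (@ArrCell A (arr_comp1 e) (arr_comp1 ac_hcomp_cod)
  (hcomp ac_hcomp_s) (hcomp ac_hcomp_t) _ _ _ _ _ _ _) => /=.
- exact: ac_eq_dom.
- exact: ac_eq_cod.
- by cfacts x; cfacts x'; move: e; intros; glob.
- by cfacts x; cfacts x'; move: e; intros; glob.
- by cfacts x; cfacts x'; move: e; intros; glob.
- by cfacts x; cfacts x'; move: e; intros; glob.
- intros; total.
  have Lx := ac_lawE x; have Lx' := ac_lawE x'.
  have Ed := ac_eq_dom x; have Ec := ac_eq_cod x.
  have Ed' := ac_eq_dom x'; have Ec' := ac_eq_cod x'.
  have hs := ac_hcomp_s; have ht := ac_hcomp_t; have hc := ac_hcomp_cod.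
  clear e1 e2 e3 e4; cfacts x; cfacts x'; intros.
  rewrite tv_assoc; gl.
  rewrite -(th_assoc (x := id2 (am_cod (ac_dom x')))); gl.
  rewrite -th_tv; gl.
  rewrite Lx' tv_idl; gl.
  rewrite -{1}(@tv_idr _ (ac_src x) (am_src (ac_cod x))); gl.
  rewrite th_tv; gl.
  rewrite -tv_assoc; gl.
  rewrite (th_assoc (x := ac_tgt x')); gl.
  rewrite -th_tv; gl.
  rewrite e Lx tv_idl; gl.
  rewrite -{1}(@tv_idr _ (ac_tgt x') (am_tgt (ac_cod x'))); gl.
  rewrite th_tv; gl.
  rewrite tv_assoc; gl.
  rewrite th_assoc; gl.
Defined.
End HComp.

Lemma arr_comp1_idl (x : arr_mor A) e : @arr_comp1 (arr_id1 (am_cod x)) x e = x.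
Proof.
apply: arr_mor_eq => //=; total; mfacts x; intros.
- by rewrite tc_idl; gl.
- by rewrite tc_idl; gl.
- rewrite th_idl; gl. rewrite th_id2; gl. rewrite tv_idr; gl.
Qed.
Lemma arr_comp1_idr (x : arr_mor A) e : @arr_comp1 x (arr_id1 (am_dom x)) e = x.
Proof.
apply: arr_mor_eq => //=; total; mfacts x; intros.
- by rewrite tc_idr; gl.
- by rewrite tc_idr; gl.
- rewrite th_idr; gl. rewrite th_id2; gl. rewrite tv_idl; gl.
Qed.
Lemma arr_comp1_assoc (z y x : arr_mor A) e1 e2 e3 e4 :
  @arr_comp1 (@arr_comp1 z y e1) x e2 = @arr_comp1 z (@arr_comp1 y x e3) e4.
Proof.
apply: arr_mor_eq => //=; total; simpl in *; mfacts x; mfacts y; mfacts z; intros.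
- by glob.
- by glob.
- total. rewrite th_wr; gl. rewrite th_wl; gl.
  rewrite -th_id2; gl. rewrite -th_id2; gl.
  rewrite !th_assoc; gl. rewrite tv_assoc; gl.
Qed.
Lemma arr_comp1_eq (x' x y' y : arr_mor A) e e' : x' = y' -> x = y ->
  @arr_comp1 x' x e = @arr_comp1 y' y e'.
Proof. by move=> h1 h2; subst; rewrite (proof_irrelevance _ e e'). Qed.

Definition arrow : twocat.
Proof.
refine (@TwoCat arr_elt
  (@am_dom A) (@am_cod A) (@ac_dom A) (@ac_cod A)
  arr_id1 arr_id2 arr_comp1 arr_hcomp arr_vcomp
  _ _ _ _ _ _ _ _ _ _ _ _ _ _ _ _ _ _ _ _ _ _ _) => //=.
- exact: ac_eq_dom.
- exact: ac_eq_cod.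
- by intros; apply: arr_comp1_eq.
- by intros; apply: arr_comp1_eq.
- exact: arr_comp1_idl.
- exact: arr_comp1_idr.
- exact: arr_comp1_assoc.
- by intros; apply: arr_cell_eq => //=; total; apply: tv_idl; cfacts x.
- by intros; apply: arr_cell_eq => //=; total; apply: tv_idr; cfacts x.
- intros; apply: arr_cell_eq => //=; total; apply: tv_assoc;
    by rewrite ?ac_src_tgt ?ac_src_src ?ac_tgt_tgt ?ac_tgt_src ?e1 ?e2 ?e3.
- intros; apply: arr_cell_eq => /=; total.
  + exact: arr_comp1_idl.
  + by move: (ac_hcomp_cod _) => /=; rewrite -ac_eq_cod; exact: arr_comp1_idl.
  + by apply: th_idl; cfacts x; intros; glob.
  + by apply: th_idl; cfacts x; intros; glob.
- intros; apply: arr_cell_eq => /=; total.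
  + exact: arr_comp1_idr.
  + by move: (ac_hcomp_cod _) => /=; rewrite -ac_eq_dom; exact: arr_comp1_idr.
  + by apply: th_idr; cfacts x; intros; glob.
  + by apply: th_idr; cfacts x; intros; glob.
- intros; apply: arr_cell_eq => /=; total.
  + exact: arr_comp1_assoc.
  + exact: arr_comp1_assoc.
  + by apply: th_assoc; rewrite !ac_src_src; exact: am_comp_s.
  + by apply: th_assoc; rewrite !ac_tgt_src; exact: am_comp_t.
- intros; apply: arr_cell_eq => /=; total.
  + exact: arr_comp1_eq.
  + exact: arr_comp1_eq.
  + by apply: th_id2; exact: am_comp_s.
  + by apply: th_id2; exact: am_comp_t.
- intros; apply: arr_cell_eq => /=; total.
  + exact: arr_comp1_eq.
  + exact: arr_comp1_eq.
  + apply: th_tv; rewrite ?ac_src_src ?ac_src_tgt ?e1 ?e2 //; exact: am_comp_s.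
  + apply: th_tv; rewrite ?ac_tgt_src ?ac_tgt_tgt ?e1 ?e2 //; exact: am_comp_t.
Defined.
End ArrowTwocat.

Definition arr_src (A : twocat) : functor (arrow A) A.
Proof.
refine (@Functor (arrow A) A (fun d => match d with
    Ob => @src1 A | Mor => @am_src A | Cel => @ac_src A end)
  _ _ _ _ _ _ _ _ _) => //=; intros.
- by rewrite am_src_src.
- exact: am_src_tgt.
- by rewrite ac_src_src.
- by rewrite ac_src_tgt.
- exact: comp_eq.
- exact: hcomp_eq.
- exact: vcomp_eq.
Defined.

Definition arr_tgt (A : twocat) : functor (arrow A) A.
Proof.
refine (@Functor (arrow A) A (fun d => match d with
    Ob => @tgt1 A | Mor => @am_tgt A | Cel => @ac_tgt A end)
  _ _ _ _ _ _ _ _ _) => //=; intros.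
- by rewrite am_tgt_src.
- by rewrite am_tgt_tgt.
- by rewrite ac_tgt_src.
- by rewrite ac_tgt_tgt.
- exact: comp_eq.
- exact: hcomp_eq.
- exact: vcomp_eq.
Defined.

(* The unit 2-functor, a |-> (a, id_a, a). *)
Section Unit.
Variable A : twocat.

Definition arr_unit1 (s : A Mor) : arr_mor A.
Proof.
unshelve refine
  (@ArrMor A (id1 (src1 s)) (id1 (tgt1 s)) s s (id2 s) _ _ _ _ _ _);
by rewrite ?compE ?src1_id1 ?tgt1_id1 ?src2_id2 ?tgt2_id2 ?tc_idl ?tc_idr.
Defined.

Definition arr_unit2 (x : A Cel) : arr_cell A.
Proof.
unshelve refine
  (@ArrCell A (arr_unit1 (src2 x)) (arr_unit1 (tgt2 x)) x x _ _ _ _ _ _ _)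
  => //=.
- by rewrite src1_tgt2.
- by rewrite tgt1_tgt2.
- by intros; total; rewrite th_idl // th_idr // tv_idl // tv_idr.
Defined.

Lemma arr_unit1_comp (t s r : A Mor) (e : src1 t = tgt1 s) e' : r = comp e ->
  arr_unit1 r = @arr_comp1 A (arr_unit1 t) (arr_unit1 s) e'.
Proof.
move=> ->; apply: arr_mor_eq => //=.
- by rewrite src1_comp.
- by rewrite tgt1_comp.
- exact: comp_eq.
- exact: comp_eq.
- by total; rewrite th_id2 // tv_idl // src2_id2.
Qed.

Definition arr_unit : functor A (arrow A).
Proof.
refine (@Functor A (arrow A) (fun d => match d with
    Ob => @id1 A | Mor => arr_unit1 | Cel => arr_unit2 end)
  _ _ _ _ _ _ _ _ _) => //=; intros.
- by apply: arr_mor_eq => //=; rewrite ?src1_id1 ?tgt1_id1.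
- by apply: arr_cell_eq => //=; rewrite ?src2_id2 ?tgt2_id2.
- exact: arr_unit1_comp.
- have e1 : src1 (tgt2 x) = tgt1 (tgt2 y) by rewrite src1_tgt2 tgt1_tgt2.
  apply: arr_cell_eq => /=; try exact: hcomp_eq.
  + by apply: arr_unit1_comp; exact: src2_hcomp.
  + by apply: (arr_unit1_comp (e := e1)); exact: tgt2_hcomp.
- by apply: arr_cell_eq => /=; rewrite ?src2_vcomp ?tgt2_vcomp //;
    exact: vcomp_eq.
Defined.
End Unit.

(* The composition 2-functor, (a, u, b, v, c) |-> (a, v u, c). *)
Section Mul.
Variable A : twocat.

Section Mor.
Variables (x y : arr_mor A) (e : am_tgt x = am_src y).

Lemma mul_1 : src1 (am_dom y) = tgt1 (am_dom x).
Proof. by rewrite -am_src_src -e am_tgt_src. Qed.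
Lemma mul_2 : src1 (am_cod y) = tgt1 (am_cod x).
Proof. by rewrite am_src_tgt -e am_tgt_tgt. Qed.
Lemma mul_3 : src1 (src2 (am_cell y)) = tgt1 (src2 (id2 (am_dom x))).
Proof. by rewrite src2_id2 am_cell_src src1_comp mul_1. Qed.
Lemma mul_4 : src1 (src2 (id2 (am_cod y))) = tgt1 (src2 (am_cell x)).
Proof. by rewrite src2_id2 am_cell_src tgt1_comp am_tgt_tgt mul_2. Qed.
Lemma mul_5 : tgt2 (hcomp mul_3) = src2 (hcomp mul_4).
Proof.
have := mul_1; have := mul_2; move: e; mfacts x; mfacts y; intros; glob.
Qed.

Definition arr_mul1 : arr_mor A.
Proof.
unshelve refine (@ArrMor A (comp mul_1) (comp mul_2) (am_src x) (am_tgt y)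
  (vcomp mul_5) _ _ _ _ _ _);
have := mul_1; have := mul_2; move: e; mfacts x; mfacts y; intros; glob.
Defined.
End Mor.

Section Cel.
Variables (x y : arr_cell A) (e : ac_tgt x = ac_src y).

Lemma mul_dom : am_tgt (ac_dom x) = am_src (ac_dom y).
Proof. by rewrite -ac_tgt_src e ac_src_src. Qed.
Lemma mul_cod : am_tgt (ac_cod x) = am_src (ac_cod y).
Proof. by rewrite -ac_tgt_tgt e ac_src_tgt. Qed.

Definition arr_mul2 : arr_cell A.
Proof.
unshelve refine (@ArrCell A (arr_mul1 mul_dom) (arr_mul1 mul_cod)
  (ac_src x) (ac_tgt y) _ _ _ _ _ _ _) => /=.
- by apply: comp_eq; rewrite ac_eq_dom.
- by apply: comp_eq; rewrite ac_eq_cod.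
- exact: ac_src_src.
- exact: ac_src_tgt.
- exact: ac_tgt_src.
- exact: ac_tgt_tgt.
- intros; total; clear e1 e2 e3 e4.
  have Lx := ac_lawE x; have Ly := ac_lawE y.
  have h1 := mul_1 mul_dom; have h2 := mul_2 mul_dom; 
  have h3 := mul_1 mul_cod; have h4 := mul_2 mul_cod.
  have h5 := mul_dom; have h6 := mul_cod.
  have Ex := ac_eq_dom x; have Ey := ac_eq_dom y.
  have Fx := ac_eq_cod x; have Fy := ac_eq_cod y.
  cfacts x; cfacts y; intros.
  rewrite tv_assoc; gl.
  rewrite -th_id2; gl. rewrite th_assoc; gl.
  rewrite -th_wl; gl.
  rewrite Lx th_wl; gl.
  rewrite -tv_assoc; gl.
  rewrite -th_assoc; gl.
  rewrite -th_wr; gl.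
  rewrite e Ly th_wr; gl.
  rewrite Ex Fy -th_id2; gl.
  rewrite -th_assoc; gl.
  rewrite tv_assoc; gl.
Defined.
End Cel.

Lemma arr_mul1_eq (x y x' y' : arr_mor A) e e' : x = x' -> y = y' ->
  @arr_mul1 x y e = @arr_mul1 x' y' e'.
Proof. by move=> h1 h2; subst; rewrite (proof_irrelevance _ e e'). Qed.

Lemma arr_mul1_comp (x' x y' y : arr_mor A) ex ey h h' h'' k :
  @arr_mul1 (@arr_comp1 A x' x ex) (@arr_comp1 A y' y ey) h
  = @arr_comp1 A (@arr_mul1 x' y' h') (@arr_mul1 x y h'') k.
Proof.
apply: arr_mor_eq => /=; try (exact: comp_eq).
have h1 := mul_1 h''; have h2 := mul_2 h''.
have h3 := mul_1 h'; have h4 := mul_2 h'.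
total; clear h k; mfacts x; mfacts y; mfacts x'; mfacts y'.
intros.
have i1 : src1 (am_src y') = tgt1 (am_src y) by congruence.
have i2 : src1 (am_tgt y') = tgt1 (am_tgt y) by congruence.
have i3 : src1 (am_src x') = tgt1 (am_src x) by congruence.
have i4 : src1 (am_tgt x') = tgt1 (am_tgt x) by congruence.
rewrite !th_wl; gl. rewrite !th_wr; gl.
rewrite !tv_assoc; gl.
rewrite !th_assoc; gl. rewrite ?th_id2; gl.
f_equal; rewrite -!tv_assoc; gl; f_equal.
rewrite -!th_assoc; gl. rewrite !th_id2; gl.
have := @th_lr A (am_cell y') (am_cell x).
rewrite H H0 H17 H18 ex ey h' -h'' => L; apply: L; glob.
Qed.

Definition arr_mul : functor (pullback (arr_tgt A) (arr_src A)) (arrow A).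
Proof.
refine (@Functor (pullback (arr_tgt A) (arr_src A)) (arrow A) (fun d =>
    match d return pb (arr_tgt A d) (arr_src A d) -> arrow A d with
    | Ob => fun z => @comp A (pb2 z) (pb1 z) (eq_sym (pbE z))
    | Mor => fun z => @arr_mul1 (pb1 z) (pb2 z) (pbE z)
    | Cel => fun z => @arr_mul2 (pb1 z) (pb2 z) (pbE z)
    end)
  _ _ _ _ _ _ _ _ _) => //=.
- by intros; exact: comp_eq.
- by intros; exact: comp_eq.
- by intros; exact: arr_mul1_eq.
- by intros; exact: arr_mul1_eq.
- move=> [u v /= e]; apply: arr_mor_eq => //=.
  + exact: comp_eq.
  + exact: comp_eq.
  + by rewrite src1_comp.
  + by rewrite tgt1_comp.
  + by total; rewrite !th_id2 // tv_idl // src2_id2.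
- by move=> [x y /= e]; apply: arr_cell_eq => //=; exact: arr_mul1_eq.
- by intros; exact: arr_mul1_comp.
- intros; apply: arr_cell_eq => /=; try exact: hcomp_eq.
  + exact: arr_mul1_comp.
  + exact: arr_mul1_comp.
- by intros; apply: arr_cell_eq => /=; try exact: vcomp_eq; exact: arr_mul1_eq.
Defined.
End Mul.

(* The 2-functor between lax arrow 2-categories induced by [f]. *)
Section Map.
Variables (A C : twocat) (f : functor A C).

Lemma f_tc (t s : A Mor) : src1 t = tgt1 s ->
  f Mor (tc t s) = tc (f Mor t) (f Mor s).
Proof.
move=> e; have e' : src1 (f Mor t) = tgt1 (f Mor s).
  by rewrite -f_src1 -f_tgt1 e.
by rewrite -(compE e) -(compE e'); exact: f_comp.
Qed.
Lemma f_th (x y : A Cel) : src1 (src2 x) = tgt1 (src2 y) ->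
  f Cel (th x y) = th (f Cel x) (f Cel y).
Proof.
move=> e; have e' : src1 (src2 (f Cel x)) = tgt1 (src2 (f Cel y)).
  by rewrite -!f_src2 -f_src1 -f_tgt1 e.
by rewrite -(hcompE e) -(hcompE e'); exact: f_hcomp.
Qed.
Lemma f_tv (x y : A Cel) : tgt2 x = src2 y ->
  f Cel (tv x y) = tv (f Cel x) (f Cel y).
Proof.
move=> e; have e' : tgt2 (f Cel x) = src2 (f Cel y) by rewrite -f_src2 -f_tgt2 e.
by rewrite -(vcompE e) -(vcompE e'); exact: f_vcomp.
Qed.

Definition arr_map1 (x : arr_mor A) : arr_mor C.
Proof.
unshelve refine (@ArrMor C (f Mor (am_dom x)) (f Mor (am_cod x))
  (f Mor (am_src x)) (f Mor (am_tgt x)) (f Cel (am_cell x)) _ _ _ _ _ _).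
- by rewrite -f_src1 -f_tgt1 am_src_tgt.
- by rewrite -f_src1 -f_tgt1 am_tgt_src.
- by rewrite -!f_src1 am_src_src.
- by rewrite -!f_tgt1 am_tgt_tgt.
- by rewrite -f_src2 am_cell_src; exact: f_comp.
- by rewrite -f_tgt2 am_cell_tgt; exact: f_comp.
Defined.

Definition arr_map2 (x : arr_cell A) : arr_cell C.
Proof.
unshelve refine (@ArrCell C (arr_map1 (ac_dom x)) (arr_map1 (ac_cod x))
  (f Cel (ac_src x)) (f Cel (ac_tgt x)) _ _ _ _ _ _ _) => /=.
- by rewrite ac_eq_dom.
- by rewrite ac_eq_cod.
- by rewrite -f_src2 ac_src_src.
- by rewrite -f_tgt2 ac_src_tgt.
- by rewrite -f_src2 ac_tgt_src.
- by rewrite -f_tgt2 ac_tgt_tgt.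
- intros; total; clear e1 e2 e3 e4.
  have := f_equal (f Cel) (ac_lawE x); cfacts x; intros.
  by rewrite -!f_id2 -!f_th -?f_tv; gl.
Defined.

Lemma arr_map1_comp (t s : arr_mor A) e e' :
  arr_map1 (@arr_comp1 A t s e) = @arr_comp1 C (arr_map1 t) (arr_map1 s) e'.
Proof.
apply: arr_mor_eq => //=; try exact: f_comp.
have := am_comp_s e; have := am_comp_t e; total; mfacts s; mfacts t.
move: (e); clear e'; intros.
by rewrite f_tv; gl; rewrite !f_th; gl; rewrite !f_id2.
Qed.

Definition arr_map : functor (arrow A) (arrow C).
Proof.
refine (@Functor (arrow A) (arrow C) (fun d => match d with
    Ob => f Mor | Mor => arr_map1 | Cel => arr_map2 end)
  _ _ _ _ _ _ _ _ _) => //=; intros.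
- by apply: arr_mor_eq => //=; rewrite ?f_id1 ?f_id2 ?f_src1 ?f_tgt1.
- by apply: arr_cell_eq => //=; exact: f_id2.
- exact: arr_map1_comp.
- apply: arr_cell_eq => /=; try exact: f_hcomp; exact: arr_map1_comp.
- by apply: arr_cell_eq => //=; exact: f_vcomp.
Defined.
End Map.

Lemma arr_src_map (A C : twocat) (f : functor A C) d (x : arrow A d) :
  arr_src C d (arr_map f d x) = f d (arr_src A d x).
Proof. by case: d x => x /=; rewrite ?f_src1. Qed.
Lemma arr_tgt_map (A C : twocat) (f : functor A C) d (x : arrow A d) :
  arr_tgt C d (arr_map f d x) = f d (arr_tgt A d x).
Proof. by case: d x => x /=; rewrite ?f_tgt1. Qed.
Lemma arr_src_unit (A : twocat) d (a : A d) :
  arr_src A d (arr_unit A d a) = a.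
Proof. by case: d a => a //=; exact: src1_id1. Qed.
Lemma arr_tgt_unit (A : twocat) d (a : A d) :
  arr_tgt A d (arr_unit A d a) = a.
Proof. by case: d a => a //=; exact: tgt1_id1. Qed.
Lemma arr_src_mul (A : twocat) d (z : pullback (arr_tgt A) (arr_src A) d) :
  arr_src A d (arr_mul A d z) = arr_src A d (pb1 z).
Proof. by case: d z => z //=; exact: src1_comp. Qed.
Lemma arr_tgt_mul (A : twocat) d (z : pullback (arr_tgt A) (arr_src A) d) :
  arr_tgt A d (arr_mul A d z) = arr_tgt A d (pb2 z).
Proof. by case: d z => z //=; exact: tgt1_comp. Qed.

(** * Split two-sided 2-fibrations *)

(* The 2-functor into a strict pullback induced by [F] and [G]. *)
Definition pairing (W X Y Z : twocat) (H : functor X Z) (K : functor Y Z)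
  (F : functor W X) (G : functor W Y)
  (e : forall d w, H d (F d w) = K d (G d w)) : functor W (pullback H K).
Proof.
refine (@Functor W (pullback H K) (fun d w => Pb _ _ (e d w)) _ _ _ _ _ _ _ _ _);
  intros; apply: pb_eq.
1-2: exact: f_src1.
1-2: exact: f_tgt1.
1-2: exact: f_src2.
1-2: exact: f_tgt2.
1-2: exact: f_id1.
1-2: exact: f_id2.
1-2: exact: f_comp.
1-2: exact: f_hcomp.
1-2: exact: f_vcomp.
Defined.

(* Equalities of 2-functors are stated elementwise: on objects, morphisms and
   cells ([d] ranges over the three dimensions).  The proofs [e1], [e2] and [e]
   of matching always exist, by the preceding fields. *)
Record s2fib (A B : twocat) := S2Fib {
  apex :> twocat;
  lp : functor apex A;
  rq : functor apex B;
  lam : functor (pullback (arr_tgt A) lp) apex;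
  rho : functor (pullback rq (arr_src B)) apex;
  lp_lam : forall d z, lp d (lam d z) = arr_src A d (pb1 z);
  rq_lam : forall d z, rq d (lam d z) = rq d (pb2 z);
  lp_rho : forall d z, lp d (rho d z) = lp d (pb1 z);
  rq_rho : forall d z, rq d (rho d z) = arr_tgt B d (pb2 z);
  lam_mul : forall d x y i (exy : arr_tgt A d x = arr_src A d y)
      (eyi : arr_tgt A d y = lp d i) e1 e2,
    lam d (Pb (arr_mul A d (Pb x y exy)) i e1)
    = lam d (Pb x (lam d (Pb y i eyi)) e2);
  lam_unit : forall d i e, lam d (Pb (arr_unit A d (lp d i)) i e) = i;
  rho_mul : forall d i y z (eiy : rq d i = arr_src B d y)
      (eyz : arr_tgt B d y = arr_src B d z) e1 e2,
    rho d (Pb i (arr_mul B d (Pb y z eyz)) e1)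
    = rho d (Pb (rho d (Pb i y eiy)) z e2);
  rho_unit : forall d i e, rho d (Pb i (arr_unit B d (rq d i)) e) = i;
  rho_lam : forall d x i y (exi : arr_tgt A d x = lp d i)
      (eiy : rq d i = arr_src B d y) e1 e2,
    rho d (Pb (lam d (Pb x i exi)) y e1)
    = lam d (Pb x (rho d (Pb i y eiy)) e2)
}.
Arguments lp {A B} s : rename.
Arguments rq {A B} s : rename.
Arguments lam {A B} s : rename.
Arguments rho {A B} s : rename.

Definition locally_discrete (A B : twocat) (J : s2fib A B) : Prop :=
  forall x : J Cel, is_id2 (lp J Cel x) -> is_id2 (rq J Cel x) -> is_id2 x.

(** ** The associated cleavages *)

Section ArrowGenerators.
Variable A : twocat.

(* (id_a, id_u, u) : (a, id_a, a) -> (a, u, b), for u : a -> b *)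
Definition arr_from_id (u : A Mor) : arrow A Mor.
Proof.
unshelve refine
  (@ArrMor A (id1 (src1 u)) u (id1 (src1 u)) u (id2 u) _ _ _ _ _ _);
by rewrite ?compE ?src1_id1 ?tgt1_id1 ?src2_id2 ?tgt2_id2 ?tc_idl ?tc_idr.
Defined.

(* (u, id_u, id_b) : (a, u, b) -> (b, id_b, b), for u : a -> b *)
Definition arr_to_id (u : A Mor) : arrow A Mor.
Proof.
unshelve refine
  (@ArrMor A u (id1 (tgt1 u)) u (id1 (tgt1 u)) (id2 u) _ _ _ _ _ _);
by rewrite ?compE ?src1_id1 ?tgt1_id1 ?src2_id2 ?tgt2_id2 ?tc_idl ?tc_idr.
Defined.

(* (v, x, u) : (a, id_a, a) -> (b, id_b, b), for x : u => v : a -> b *)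
Definition arr_of_cell (x : A Cel) : arrow A Mor.
Proof.
unshelve refine
  (@ArrMor A (id1 (src1 (src2 x))) (id1 (tgt1 (src2 x))) (tgt2 x) (src2 x) x
    _ _ _ _ _ _);
by rewrite ?compE ?src1_tgt2 ?tgt1_tgt2 ?src1_id1 ?tgt1_id1 ?tc_idl ?tc_idr
     ?tgt1_tgt2.
Defined.

(* (x, id_u) : (u, id_u, u) => (v, x, u), for x : u => v *)
Definition arr_from_cell (x : A Cel) : arrow A Cel.
Proof.
unshelve refine
  (@ArrCell A (arr_unit A Mor (src2 x)) (arr_of_cell x) x (id2 (src2 x))
    _ _ _ _ _ _ _) => //=; rewrite ?src2_id2 ?tgt2_id2 //.
intros; total; rewrite th_idl // th_id2 ?tgt1_id1 // tc_idr // tv_idl //.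
Defined.

(* (id_v, x) : (v, x, u) => (v, id_v, v), for x : u => v *)
Definition arr_to_cell (x : A Cel) : arrow A Cel.
Proof.
unshelve refine
  (@ArrCell A (arr_of_cell x) (arr_unit A Mor (tgt2 x)) (id2 (tgt2 x)) x
    _ _ _ _ _ _ _) => //=;
  rewrite ?src2_id2 ?tgt2_id2 ?src1_tgt2 ?tgt1_tgt2 //.
intros; total; rewrite th_idr // th_id2 ?src1_id1 ?tgt1_tgt2 // tc_idl ?tgt1_tgt2 //.
Defined.

End ArrowGenerators.

Section Cleavages.
Variables (A B : twocat) (J : s2fib A B).

Lemma lam_mor_pf (u : A Mor) (i : J Ob) : tgt1 u = lp J Ob i ->
  arr_tgt A Mor (arr_to_id u) = lp J Mor (id1 i).
Proof. by move=> e; rewrite f_id1 -e. Qed.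
Lemma lam_cel_pf (s : J Mor) (x : A Cel) : lp J Mor s = src2 x ->
  arr_tgt A Cel (arr_from_cell x) = lp J Cel (id2 s).
Proof. by move=> e; rewrite f_id2 e. Qed.
Lemma rho_mor_pf (i : J Ob) (v : B Mor) : rq J Ob i = src1 v ->
  rq J Mor (id1 i) = arr_src B Mor (arr_from_id v).
Proof. by move=> e; rewrite f_id1 e. Qed.
Lemma rho_cel_pf (x : B Cel) (s : J Mor) : tgt2 x = rq J Mor s ->
  rq J Cel (id2 s) = arr_src B Cel (arr_to_cell x).
Proof. by move=> e; rewrite f_id2 -e. Qed.

(* lambda_p(u, i) : u^* i -> i *)
Definition lam_mor (u : A Mor) (i : J Ob) (e : tgt1 u = lp J Ob i) : J Mor :=
  lam J Mor (Pb (arr_to_id u) (id1 i) (lam_mor_pf e)).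
(* lambda_p(s, x) : s => x_! s *)
Definition lam_cel (s : J Mor) (x : A Cel) (e : lp J Mor s = src2 x) : J Cel :=
  lam J Cel (Pb (arr_from_cell x) (id2 s) (lam_cel_pf e)).
(* rho_q(i, v) : i -> v_! i *)
Definition rho_mor (i : J Ob) (v : B Mor) (e : rq J Ob i = src1 v) : J Mor :=
  rho J Mor (Pb (id1 i) (arr_from_id v) (rho_mor_pf e)).
(* rho_q(x, s) : x^* s => s *)
Definition rho_cel (x : B Cel) (s : J Mor) (e : tgt2 x = rq J Mor s) : J Cel :=
  rho J Cel (Pb (id2 s) (arr_to_cell x) (rho_cel_pf e)).

Lemma lp_lam_mor u i e : lp J Mor (@lam_mor u i e) = u.
Proof. exact: lp_lam. Qed.
Lemma lp_lam_cel s x e : lp J Cel (@lam_cel s x e) = x.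
Proof. exact: lp_lam. Qed.
Lemma rq_rho_mor i v e : rq J Mor (@rho_mor i v e) = v.
Proof. exact: rq_rho. Qed.
Lemma rq_rho_cel x s e : rq J Cel (@rho_cel x s e) = x.
Proof. exact: rq_rho. Qed.

End Cleavages.

(** * Iterated spans and their pullbacks *)

(* Iterated spans J_1, ..., J_n of split two-sided 2-fibrations, n >= 1. *)
Inductive path : twocat -> twocat -> Type :=
| pone A B : s2fib A B -> path A B
| pcons A B C : s2fib A B -> path B C -> path A C.

Fixpoint path_locally_discrete A B (P : path A B) : Prop :=
  match P with
  | pone J => locally_discrete J
  | pcons J P => locally_discrete J /\ path_locally_discrete P
  end.

(* The span composite J x_B K, as a split two-sided 2-fibration with lambda
   acting on J and rho acting on K:
   lambda(x,(j,k)) = (lambda(x,j),k) and rho((j,k),y) = (j,rho(k,y)). *)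
Section Composite.
Variables (A B C : twocat) (J : s2fib A B) (K : s2fib B C).

Let JK : twocat := pullback (rq J) (lp K).
Let p : functor JK A := fcompose (lp J) (pr1 (rq J) (lp K)).
Let q : functor JK C := fcompose (rq K) (pr2 (rq J) (lp K)).

Definition comp_lam1 : functor (pullback (arr_tgt A) p) J :=
  fcompose (lam J)
    (@pairing _ _ _ _ (arr_tgt A) (lp J)
       (pr1 (arr_tgt A) p) (fcompose (pr1 (rq J) (lp K)) (pr2 (arr_tgt A) p))
       (fun d z => pbE z)).

Lemma comp_lam_pf d (z : pullback (arr_tgt A) p d) :
  rq J d (comp_lam1 d z) = lp K d (pb2 (pb2 z)).
Proof. by rewrite /= rq_lam /= pbE. Qed.

Definition comp_lam : functor (pullback (arr_tgt A) p) JK :=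
  @pairing _ _ _ _ (rq J) (lp K)
    comp_lam1 (fcompose (pr2 (rq J) (lp K)) (pr2 (arr_tgt A) p)) comp_lam_pf.

Definition comp_rho2 : functor (pullback q (arr_src C)) K :=
  fcompose (rho K)
    (@pairing _ _ _ _ (rq K) (arr_src C)
       (fcompose (pr2 (rq J) (lp K)) (pr1 q (arr_src C))) (pr2 q (arr_src C))
       (fun d z => pbE z)).

Lemma comp_rho_pf d (z : pullback q (arr_src C) d) :
  rq J d (pb1 (pb1 z)) = lp K d (comp_rho2 d z).
Proof. by rewrite /= lp_rho /= pbE. Qed.

Definition comp_rho : functor (pullback q (arr_src C)) JK :=
  @pairing _ _ _ _ (rq J) (lp K)
    (fcompose (pr1 (rq J) (lp K)) (pr1 q (arr_src C))) comp_rho2 comp_rho_pf.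

Definition fcomposite : s2fib A C.
Proof.
refine (@S2Fib A C JK p q comp_lam comp_rho _ _ _ _ _ _ _ _ _).
- by move=> d z; rewrite /= lp_lam.
- by [].
- by [].
- by move=> d z; rewrite /= rq_rho.
- by intros; apply: pb_eq => //=; exact: lam_mul.
- by intros; apply: pb_eq => //=; exact: lam_unit.
- by intros; apply: pb_eq => //=; exact: rho_mul.
- by intros; apply: pb_eq => //=; exact: rho_unit.
- by intros; apply: pb_eq => /=; congr (fmap _ _ _); apply: pb_eq.
Defined.
End Composite.

(* The iterated pullback of the path J_1, ..., J_n, with lambda acting on the
   first component and rho on the last:
   lambda(x,(i_1,...,i_n)) = (lambda(x,i_1),i_2,...,i_n) and
   rho((i_1,...,i_n),y) = (i_1,...,i_{n-1},rho(i_n,y)). *)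
Fixpoint iprod A B (P : path A B) : s2fib A B :=
  match P with
  | pone J => J
  | pcons J P => fcomposite J (iprod P)
  end.

(* Consequently the cleavages of [iprod P] are
   lambda_p(u,(i_1,...,i_n)) = (lambda_{p_1}(u,i_1),id,...,id),
   rho_q((i_1,...,i_n),v) = (id,...,id,rho_{q_n}(i_n,v)), and similarly for
   cells. *)

Section ProdCleavages.
Variables (A B C : twocat) (J : s2fib A B) (P : path B C).
Let JP := iprod (pcons J P).

Lemma lam_mor_pcons (u : A Mor) (i : JP Ob) e e' :
  @lam_mor A C JP u i e = Pb (@lam_mor A B J u (pb1 i) e) (id1 (pb2 i)) e'.
Proof. by apply: pb_eq => //=; congr (fmap _ _ _); apply: pb_eq. Qed.

Lemma lam_cel_pcons (s : JP Mor) (x : A Cel) e e' :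
  @lam_cel A C JP s x e = Pb (@lam_cel A B J (pb1 s) x e) (id2 (pb2 s)) e'.
Proof. by apply: pb_eq => //=; congr (fmap _ _ _); apply: pb_eq. Qed.

Lemma rho_mor_pcons (i : JP Ob) (v : C Mor) e e' :
  @rho_mor A C JP i v e
  = Pb (id1 (pb1 i)) (@rho_mor B C (iprod P) (pb2 i) v e) e'.
Proof. by apply: pb_eq => //=; congr (fmap _ _ _); apply: pb_eq. Qed.

Lemma rho_cel_pcons (x : C Cel) (s : JP Mor) e e' :
  @rho_cel A C JP x s e
  = Pb (id2 (pb1 s)) (@rho_cel B C (iprod P) x (pb2 s) e) e'.
Proof. by apply: pb_eq => //=; congr (fmap _ _ _); apply: pb_eq. Qed.

End ProdCleavages.

(* [cut P1 P2 P] : P is the concatenation of P1 and P2.  The cuts of a path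
   J_1, ..., J_n correspond to the indices 1 <= m < n, with P1 = J_1, ..., J_m
   and P2 = J_{m+1}, ..., J_n. *)
Inductive cut : forall A B C, path A B -> path B C -> path A C -> Type :=
| cut_one A B C (J : s2fib A B) (P : path B C) : cut (pone J) P (pcons J P)
| cut_cons A A' B C (J : s2fib A A') (P1 : path A' B) (P2 : path B C)
    (P : path A' C) :
    cut P1 P2 P -> cut (pcons J P1) P2 (pcons J P).

(* The tuple (i_1, ..., i_n) obtained from matching tuples (i_1, ..., i_m) and
   (i_{m+1}, ..., i_n). *)
Fixpoint glue_sig A B C (P1 : path A B) (P2 : path B C) (P : path A C)
  (c : cut P1 P2 P) (d : dim) :
  forall (i : iprod P1 d) (j : iprod P2 d), rq (iprod P1) d i = lp (iprod P2) d j ->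
  {k : iprod P d | lp (iprod P) d k = lp (iprod P1) d i} :=
  match c in @cut A B C P1 P2 P return
    forall (i : iprod P1 d) (j : iprod P2 d),
    rq (iprod P1) d i = lp (iprod P2) d j ->
    {k : iprod P d | lp (iprod P) d k = lp (iprod P1) d i}
  with
  | cut_one J P => fun i j e => exist _ (Pb i j e) eq_refl
  | cut_cons J c => fun i j e =>
      let (k, ek) := @glue_sig _ _ _ _ _ _ c d (pb2 i) j e in
      exist _ (Pb (pb1 i) k (eq_trans (pbE i) (eq_sym ek))) eq_refl
  end.

Definition glue A B C (P1 : path A B) (P2 : path B C) (P : path A C)
  (c : cut P1 P2 P) (d : dim) (i : iprod P1 d) (j : iprod P2 d)
  (e : rq (iprod P1) d i = lp (iprod P2) d j) : iprod P d :=
  proj1_sig (glue_sig c e).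
Arguments glue {A B C P1 P2 P} c d i j e.

Lemma lp_glue A B C (P1 : path A B) (P2 : path B C) (P : path A C)
  (c : cut P1 P2 P) d (i : iprod P1 d) (j : iprod P2 d) e :
  lp (iprod P) d (glue c d i j e) = lp (iprod P1) d i.
Proof. exact: (proj2_sig (glue_sig c e)). Qed.

Lemma rq_glue A B C (P1 : path A B) (P2 : path B C) (P : path A C)
  (c : cut P1 P2 P) d (i : iprod P1 d) (j : iprod P2 d) e :
  rq (iprod P) d (glue c d i j e) = rq (iprod P2) d j.
Proof.
elim: c i j e => [//|A0 A1 B0 C0 J Q1 Q2 Q c IH] i j e; rewrite -(IH (pb2 i) j e).
by rewrite /glue /=; case: glue_sig.
Qed.

(** * Unary cells *)

(* A 2-functor from the iterated pullback to [K], over [f] and [g]. *)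
Record functor_over A0 An C D (J : path A0 An) (K : s2fib C D)
  (f : functor A0 C) (g : functor An D) := FunctorOver {
  fo :> functor (iprod J) K;
  fo_lp : forall d i, lp K d (fo d i) = f d (lp (iprod J) d i);
  fo_rq : forall d i, rq K d (fo d i) = g d (rq (iprod J) d i)
}.

Section UnaryCells.
Variables (A0 An C D : twocat) (J : path A0 An) (K : s2fib C D).
Variables (f : functor A0 C) (g : functor An D).
Variable phi : functor_over J K f g.

Lemma outer_lam_pf d (x : arrow A0 d) (i : iprod J d) :
  arr_tgt A0 d x = lp (iprod J) d i ->
  arr_tgt C d (arr_map f d x) = lp K d (phi d i).
Proof. by move=> e; rewrite arr_tgt_map fo_lp e. Qed.
Lemma outer_rho_pf d (i : iprod J d) (y : arrow An d) :
  rq (iprod J) d i = arr_src An d y ->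
  rq K d (phi d i) = arr_src D d (arr_map g d y).
Proof. by move=> e; rewrite arr_src_map fo_rq e. Qed.

(* phi(lambda(x,i_1),i_2,...,i_n) = lambda(f^2 x, phi(i_1,...,i_n)) *)
Definition lam_equivariant : Prop :=
  forall d (x : arrow A0 d) (i : iprod J d)
    (e : arr_tgt A0 d x = lp (iprod J) d i),
  phi d (lam (iprod J) d (Pb x i e))
  = lam K d (Pb (arr_map f d x) (phi d i) (outer_lam_pf e)).

(* phi(i_1,...,i_{n-1},rho(i_n,y)) = rho(phi(i_1,...,i_n), g^2 y) *)
Definition rho_equivariant : Prop :=
  forall d (i : iprod J d) (y : arrow An d)
    (e : rq (iprod J) d i = arr_src An d y),
  phi d (rho (iprod J) d (Pb i y e))
  = rho K d (Pb (phi d i) (arr_map g d y) (outer_rho_pf e)).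

Section Inner.
Variables (B : twocat) (P1 : path A0 B) (P2 : path B An).

Lemma inner_rho_pf d (i : iprod P1 d) (x : arrow B d) (j : iprod P2 d)
  (ei : rq (iprod P1) d i = arr_src B d x)
  (ej : arr_tgt B d x = lp (iprod P2) d j) :
  rq (iprod P1) d (rho (iprod P1) d (Pb i x ei)) = lp (iprod P2) d j.
Proof. by rewrite rq_rho. Qed.
Lemma inner_lam_pf d (i : iprod P1 d) (x : arrow B d) (j : iprod P2 d)
  (ei : rq (iprod P1) d i = arr_src B d x)
  (ej : arr_tgt B d x = lp (iprod P2) d j) :
  rq (iprod P1) d i = lp (iprod P2) d (lam (iprod P2) d (Pb x j ej)).
Proof. by rewrite lp_lam. Qed.
Lemma iem_pf (i : iprod P1 Ob) (u : B Mor) (j : iprod P2 Ob)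
  (ei : rq (iprod P1) Ob i = src1 u) (ej : tgt1 u = lp (iprod P2) Ob j) :
  rq (iprod P1) Mor (rho_mor ei) = lp (iprod P2) Mor (lam_mor ej).
Proof. by rewrite rq_rho_mor lp_lam_mor. Qed.
Lemma iec_pf (s : iprod P1 Mor) (x : B Cel) (t : iprod P2 Mor)
  (es : tgt2 x = rq (iprod P1) Mor s) (et : lp (iprod P2) Mor t = src2 x) :
  rq (iprod P1) Cel (rho_cel es) = lp (iprod P2) Cel (lam_cel et).
Proof. by rewrite rq_rho_cel lp_lam_cel. Qed.
End Inner.

(* phi(...,rho(i_m,x),i_{m+1},...) = phi(...,i_m,lambda(x,i_{m+1}),...) *)
Definition inner_equivariant : Prop :=
  forall B (P1 : path A0 B) (P2 : path B An) (c : cut P1 P2 J)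
    d (i : iprod P1 d) (x : arrow B d) (j : iprod P2 d)
    (ei : rq (iprod P1) d i = arr_src B d x)
    (ej : arr_tgt B d x = lp (iprod P2) d j),
  phi d (glue c d (rho (iprod P1) d (Pb i x ei)) j (inner_rho_pf ei ej))
  = phi d (glue c d i (lam (iprod P2) d (Pb x j ej)) (inner_lam_pf ei ej)).

Definition is_unary_cell : Prop :=
  lam_equivariant /\ rho_equivariant /\ inner_equivariant.

(* Unary cells between locally discrete split two-sided 2-fibrations. *)
Definition is_unary_cell_ld : Prop :=
  path_locally_discrete J /\ locally_discrete K /\ is_unary_cell.

Lemma poc_pf (s : iprod J Mor) (x : A0 Cel) :
  lp (iprod J) Mor s = src2 x -> lp K Mor (phi Mor s) = src2 (f Cel x).
Proof. by move=> e; rewrite fo_lp e f_src2. Qed.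
Lemma pcc_pf (x : An Cel) (s : iprod J Mor) :
  tgt2 x = rq (iprod J) Mor s -> tgt2 (g Cel x) = rq K Mor (phi Mor s).
Proof. by move=> e; rewrite fo_rq -e f_tgt2. Qed.
Lemma pcm_pf (u : A0 Mor) (i : iprod J Ob) :
  tgt1 u = lp (iprod J) Ob i -> tgt1 (f Mor u) = lp K Ob (phi Ob i).
Proof. by move=> e; rewrite fo_lp -e f_tgt1. Qed.
Lemma pom_pf (i : iprod J Ob) (v : An Mor) :
  rq (iprod J) Ob i = src1 v -> rq K Ob (phi Ob i) = src1 (g Mor v).
Proof. by move=> e; rewrite fo_rq e f_src1. Qed.

(* phi(lambda_{p_1}(s_1,x),id,...,id) = lambda_p(phi(s_1,...,s_n), f x) *)
Definition poc : Prop :=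
  forall (s : iprod J Mor) (x : A0 Cel) (e : lp (iprod J) Mor s = src2 x),
  phi Cel (lam_cel e) = lam_cel (poc_pf e).

(* phi(id,...,id,rho_{q_m}(x,s_m),lambda_{p_{m+1}}(s_{m+1},x),id,...,id) is an
   identity cell; (s_1,...,s_m) is [s] and (s_{m+1},...,s_n) is [t]. *)
Definition iec : Prop :=
  forall B (P1 : path A0 B) (P2 : path B An) (c : cut P1 P2 J)
    (s : iprod P1 Mor) (x : B Cel) (t : iprod P2 Mor)
    (es : tgt2 x = rq (iprod P1) Mor s) (et : lp (iprod P2) Mor t = src2 x),
  is_id2 (phi Cel (glue c Cel (rho_cel es) (lam_cel et) (iec_pf es et))).

(* phi(id,...,id,rho_{q_n}(x,s_n)) = rho_q(g x, phi(s_1,...,s_n)) *)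
Definition pcc : Prop :=
  forall (s : iprod J Mor) (x : An Cel) (e : tgt2 x = rq (iprod J) Mor s),
  phi Cel (rho_cel e) = rho_cel (pcc_pf e).

(* phi(lambda_{p_1}(u,i_1),id,...,id) = lambda_p(f u, phi(i_1,...,i_n)) *)
Definition pcm : Prop :=
  forall (i : iprod J Ob) (u : A0 Mor) (e : tgt1 u = lp (iprod J) Ob i),
  phi Mor (lam_mor e) = lam_mor (pcm_pf e).

(* phi(id,...,id,rho_{q_m}(i_m,u),lambda_{p_{m+1}}(u,i_{m+1}),id,...,id) is an
   identity morphism; (i_1,...,i_m) is [i] and (i_{m+1},...,i_n) is [j]. *)
Definition iem : Prop :=
  forall B (P1 : path A0 B) (P2 : path B An) (c : cut P1 P2 J)
    (i : iprod P1 Ob) (u : B Mor) (j : iprod P2 Ob)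
    (ei : rq (iprod P1) Ob i = src1 u) (ej : tgt1 u = lp (iprod P2) Ob j),
  is_id1 (phi Mor (glue c Mor (rho_mor ei) (lam_mor ej) (iem_pf ei ej))).

(* phi(id,...,id,rho_{q_n}(i_n,v)) = rho_q(phi(i_1,...,i_n), g v) *)
Definition pom : Prop :=
  forall (i : iprod J Ob) (v : An Mor) (e : rq (iprod J) Ob i = src1 v),
  phi Mor (rho_mor e) = rho_mor (pom_pf e).

End UnaryCells.

(* Main.v *)
From Stdlib Require Import ssreflect ProofIrrelevance.
Require Import Defs.

(** Write [E] for the iterated pullback, itself a split two-sided 2-fibration,
  so that the outer conditions only concern the cleavages of [E] and [K].

  A cell [x : s => t] of [K] whose [q]-component is an identity factors through
  the cleavage cell [lam_cel] at [s] by a cell lying over identities on both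
  sides; local discreteness makes the latter an identity, so that [x] is the
  cleavage cell ([ld_lam_cel], dually [ld_rho_cel]).  Hence any 2-functor into
  [K] over [f] and [g] preserves cleavage cells, which is (poc) and (pcc), while
  the cell of (iec) lies over identities and is therefore an identity.
  Combining the two factorizations, a cell of [K] is determined by its boundary
  and its two components ([ld_cel_eq]), so that equivariance on cells follows
  from equivariance on morphisms.

  Equivariance on objects follows from (pcm), (iem) and (pom) by comparing
  sources or targets.  For morphisms, let [x] be the square filled by
  [zeta : t u0 => u1 s], and let [j] lie over [t].  The morphism
  [m = lambda(x, j)] is the only one over [s], with the right codomain, whose
  composite with the cleavage morphism at [u1] is the target of the cleavage
  cell over [zeta] starting at the composite of [j] with the cleavage morphism
  at [u0] ([tgt2_lam_cel], [lam_mor_inj]).  So [lambda] on morphisms is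
  expressed by cleavage morphisms and cleavage cells, and a 2-functor
  preserving these preserves [lambda]; [rho] is dual.

  For inner equivariance, precompose with the 2-functor which glues tuples
  ([glue_functor]), so that there are only two factors.  The cell that pairs
  the two cleavage cells over [zeta] goes from (rho(s, x), t) after a pair of
  cleavage morphisms over [u0] to such a pair over [u1] after
  (s, lambda(x, t)).  Under (iem) and (iec) its image and those of the two
  pairs are identities, so (rho(s, x), t) and (s, lambda(x, t)) have the same
  image ([balanced_mor]).

  Conversely (pcm) and (pom) are instances of equivariance, and (iem) follows
  from inner equivariance because lambda along (id, id_u, u) sends the cleavage
  morphism at [u] to an identity ([lam_from_to_id]). *)

(** * Generators of the lax arrow 2-category *)

(** The factorization of cells of a split two-sided 2-fibration through the
  cleavage cells is the image of this one. *)
Lemma arr_from_to_cell {A : twocat} (x : A Cel) :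
  tv (arr_from_cell x) (arr_to_cell x) = arr_unit A Cel x.
Proof.
unshelve erewrite <- vcompE; first by [].
by apply: arr_cell_eq => //=; total; [apply: tv_idr|apply: tv_idl].
Qed.

(** Horizontally, the squares (id, id_u, u) and (u, id_u, id) paste to the
  identity of [u]; this makes cleavage morphisms cancellable. *)
Lemma arr_mul_from_to_id {A : twocat} (u : A Mor)
  (e : arr_tgt A Mor (arr_from_id u) = arr_src A Mor (arr_to_id u)) :
  arr_mul A Mor (Pb (arr_from_id u) (arr_to_id u) e) = @id1 (arrow A) u.
Proof.
apply: arr_mor_eq => //=; total; rewrite ?tc_idl ?tc_idr //.
by rewrite !th_id2 ?src1_id1 ?tgt1_id1 // tc_idl // tc_idr // tv_idl ?src2_id2.
Qed.

Lemma tc_arrow {A : twocat} (x' x : arrow A Mor) (e : am_dom x' = am_cod x) :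
  tc x' x = arr_comp1 e.
Proof. by rewrite -(@compE (arrow A) x' x e). Qed.

(** Every square can be collapsed onto the cell that fills it: both sides are the
  square from [am_dom x] to an identity with filler [am_cell x].  The next lemma
  collapses the other end. *)
Lemma arr_mul_of_cell_to_id {A : twocat} (x : arrow A Mor) e :
  arr_mul A Mor (Pb (arr_of_cell (am_cell x))
    (tc (arr_unit A Mor (am_tgt x)) (arr_to_id (am_dom x))) e)
  = tc (arr_to_id (am_cod x)) x.
Proof.
have e1 : am_dom (arr_unit1 (am_tgt x)) = am_cod (arr_to_id (am_dom x)).
  by rewrite /= am_tgt_src.
move: e; rewrite (tc_arrow _ _ e1) tc_arrow //= => e.
apply: arr_mor_eq => /=; total; mfacts x; move=> *.
- rewrite tc_idr; gl.
- rewrite tc_idl; gl; f_equal; gl.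
- gl.
- rewrite tc_idl ?tc_idr; gl.
- rewrite !th_id2; gl; rewrite tv_idl; gl.
  rewrite th_idl; gl; rewrite th_id2; gl; rewrite tc_idr; gl.
  rewrite th_idl; gl; rewrite tv_idl; gl; rewrite tv_idr; gl.
Qed.

Lemma arr_mul_from_id_of_cell {A : twocat} (x : arrow A Mor) e :
  arr_mul A Mor (Pb (tc (arr_from_id (am_cod x)) (arr_unit A Mor (am_src x)))
    (arr_of_cell (am_cell x)) e)
  = tc x (arr_from_id (am_dom x)).
Proof.
have e1 : am_dom (arr_from_id (am_cod x)) = am_cod (arr_unit1 (am_src x)).
  by rewrite /= am_src_tgt.
move: e; rewrite (tc_arrow _ _ e1) tc_arrow //= => e.
apply: arr_mor_eq => /=; total; mfacts x; move=> *.
- rewrite tc_idl; gl; f_equal; gl.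
- rewrite tc_idl; gl.
- rewrite tc_idl ?tc_idr; gl.
- gl.
- rewrite !th_idr; gl; rewrite !th_id2; gl; rewrite !tv_idl; gl.
  rewrite th_id2; gl; rewrite tc_idl; gl; rewrite tv_idr; gl.
Qed.

Lemma arr_map_to_id {X Y : twocat} (h : functor X Y) (u : X Mor) :
  arr_map h Mor (arr_to_id u) = arr_to_id (h Mor u).
Proof. by apply: arr_mor_eq; rewrite //= ?f_id1 ?f_id2 ?f_tgt1. Qed.

Lemma arr_map_from_id {X Y : twocat} (h : functor X Y) (u : X Mor) :
  arr_map h Mor (arr_from_id u) = arr_from_id (h Mor u).
Proof. by apply: arr_mor_eq; rewrite //= ?f_id1 ?f_id2 ?f_src1. Qed.

(** * Calculus of the actions and cleavages *)

Lemma tc_pb {X Y Z : twocat} {F : functor X Z} {G : functor Y Z}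
  {x' x : X Mor} {y' y : Y Mor} e' e e0 :
  src1 x' = tgt1 x -> src1 y' = tgt1 y ->
  @tc (pullback F G) (Pb x' y' e') (Pb x y e) = Pb (tc x' x) (tc y' y) e0.
Proof.
move=> hx hy; have h : @src1 (pullback F G) (Pb x' y' e')
    = tgt1 (Pb x y e : pullback F G Mor).
  exact: pb_eq.
by apply: pb_eq; [exact: (f_tc (pr1 F G) h)|exact: (f_tc (pr2 F G) h)].
Qed.

Lemma tv_pb {X Y Z : twocat} {F : functor X Z} {G : functor Y Z}
  {x x' : X Cel} {y y' : Y Cel} e e' e0 :
  tgt2 x = src2 x' -> tgt2 y = src2 y' ->
  @tv (pullback F G) (Pb x y e) (Pb x' y' e') = Pb (tv x x') (tv y y') e0.
Proof.
move=> hx hy; have h : @tgt2 (pullback F G) (Pb x y e)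
    = src2 (Pb x' y' e' : pullback F G Cel).
  exact: pb_eq.
by apply: pb_eq; [exact: (f_tv (pr1 F G) h)|exact: (f_tv (pr2 F G) h)].
Qed.

Section Actions.
Context {A B : twocat} {J : s2fib A B}.

(** The proofs of matching carried by the elements of a pullback are irrelevant;
  the congruence lemmas below allow replacing them. *)
Lemma lam_eq {d} {x x' : arrow A d} {i i' : J d} e e' :
  x = x' -> i = i' -> lam J d (Pb x i e) = lam J d (Pb x' i' e').
Proof. by move=> hx hi; congr (fmap _ _ _); apply: pb_eq. Qed.

Lemma rho_eq {d} {i i' : J d} {y y' : arrow B d} e e' :
  i = i' -> y = y' -> rho J d (Pb i y e) = rho J d (Pb i' y' e').
Proof. by move=> hi hy; congr (fmap _ _ _); apply: pb_eq. Qed.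

Lemma lam_arr_unit {d} {x : arrow A d} {i i' : J d} e :
  i = i' -> x = arr_unit A d (lp J d i') -> lam J d (Pb x i e) = i'.
Proof. by move=> hi hx; subst; exact: lam_unit. Qed.

Lemma rho_arr_unit {d} {i i' : J d} {y : arrow B d} e :
  i = i' -> y = arr_unit B d (rq J d i') -> rho J d (Pb i y e) = i'.
Proof. by move=> hi hy; subst; exact: rho_unit. Qed.

Lemma lam_tc {x' x : arrow A Mor} {s' s : J Mor} e' e e0 :
  src1 x' = tgt1 x -> src1 s' = tgt1 s ->
  tc (lam J Mor (Pb x' s' e')) (lam J Mor (Pb x s e))
  = lam J Mor (Pb (tc x' x) (tc s' s) e0).
Proof.
move=> hx hs; rewrite -f_tc; first exact: pb_eq.
by congr (fmap _ _ _); exact: tc_pb.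
Qed.

Lemma rho_tc {s' s : J Mor} {y' y : arrow B Mor} e' e e0 :
  src1 s' = tgt1 s -> src1 y' = tgt1 y ->
  tc (rho J Mor (Pb s' y' e')) (rho J Mor (Pb s y e))
  = rho J Mor (Pb (tc s' s) (tc y' y) e0).
Proof.
move=> hs hy; rewrite -f_tc; first exact: pb_eq.
by congr (fmap _ _ _); exact: tc_pb.
Qed.

Lemma lam_tv {x x' : arrow A Cel} {s s' : J Cel} e e' e0 :
  tgt2 x = src2 x' -> tgt2 s = src2 s' ->
  tv (lam J Cel (Pb x s e)) (lam J Cel (Pb x' s' e'))
  = lam J Cel (Pb (tv x x') (tv s s') e0).
Proof.
move=> hx hs; rewrite -f_tv; first exact: pb_eq.
by congr (fmap _ _ _); exact: tv_pb.
Qed.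

Lemma rho_tv {s s' : J Cel} {y y' : arrow B Cel} e e' e0 :
  tgt2 s = src2 s' -> tgt2 y = src2 y' ->
  tv (rho J Cel (Pb s y e)) (rho J Cel (Pb s' y' e'))
  = rho J Cel (Pb (tv s s') (tv y y') e0).
Proof.
move=> hs hy; rewrite -f_tv; first exact: pb_eq.
by congr (fmap _ _ _); exact: tv_pb.
Qed.

Lemma src1_lam_mor {u : A Mor} {i : J Ob} e :
  src1 (@lam_mor A B J u i e) = lam J Ob (Pb u i e).
Proof. by rewrite /lam_mor -f_src1; apply: lam_eq => //; exact: src1_id1. Qed.

Lemma tgt1_lam_mor {u : A Mor} {i : J Ob} e : tgt1 (@lam_mor A B J u i e) = i.
Proof.
by rewrite /lam_mor -f_tgt1; apply: lam_arr_unit; rewrite /= ?tgt1_id1 ?e.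
Qed.

Lemma src1_rho_mor {i : J Ob} {v : B Mor} e : src1 (@rho_mor A B J i v e) = i.
Proof.
by rewrite /rho_mor -f_src1; apply: rho_arr_unit; rewrite /= ?src1_id1 ?e.
Qed.

Lemma tgt1_rho_mor {i : J Ob} {v : B Mor} e :
  tgt1 (@rho_mor A B J i v e) = rho J Ob (Pb i v e).
Proof. by rewrite /rho_mor -f_tgt1; apply: rho_eq => //; exact: tgt1_id1. Qed.

Lemma src2_lam_cel {s : J Mor} {x : A Cel} e : src2 (@lam_cel A B J s x e) = s.
Proof.
by rewrite /lam_cel -f_src2; apply: lam_arr_unit; rewrite /= ?src2_id2 ?e.
Qed.

Lemma tgt2_rho_cel {x : B Cel} {s : J Mor} e : tgt2 (@rho_cel A B J x s e) = s.
Proof.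
by rewrite /rho_cel -f_tgt2; apply: rho_arr_unit; rewrite /= ?tgt2_id2 -?e.
Qed.

Lemma rq_lam_cel {s : J Mor} {x : A Cel} e :
  rq J Cel (@lam_cel A B J s x e) = id2 (rq J Mor s).
Proof. by rewrite /lam_cel rq_lam /= f_id2. Qed.

Lemma lp_rho_cel {x : B Cel} {s : J Mor} e :
  lp J Cel (@rho_cel A B J x s e) = id2 (lp J Mor s).
Proof. by rewrite /rho_cel lp_rho /= f_id2. Qed.

Lemma lam_mor_eq {u u' : A Mor} {i i' : J Ob} e e' :
  u = u' -> i = i' -> @lam_mor A B J u i e = @lam_mor A B J u' i' e'.
Proof. by move=> hu hi; subst; apply: lam_eq. Qed.

Lemma rho_mor_eq {i i' : J Ob} {v v' : B Mor} e e' :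
  i = i' -> v = v' -> @rho_mor A B J i v e = @rho_mor A B J i' v' e'.
Proof. by move=> hi hv; subst; apply: rho_eq. Qed.

Lemma lam_cel_eq {s s' : J Mor} {x x' : A Cel} e e' :
  s = s' -> x = x' -> @lam_cel A B J s x e = @lam_cel A B J s' x' e'.
Proof. by move=> hs hx; subst; apply: lam_eq. Qed.

Lemma rho_cel_eq {x x' : B Cel} {s s' : J Mor} e e' :
  x = x' -> s = s' -> @rho_cel A B J x s e = @rho_cel A B J x' s' e'.
Proof. by move=> hx hs; subst; apply: rho_eq. Qed.

(** The cleavage cells are opcartesian for [p]: the second factor lies over an
  identity of [A]. *)
Lemma lam_cel_tv {x : J Cel} {s : J Mor} {y : A Cel} e e' :
  s = src2 x -> y = lp J Cel x ->
  tv (@lam_cel A B J s y e) (lam J Cel (Pb (arr_to_cell y) x e')) = x.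
Proof.
move=> hs hy; subst; rewrite /lam_cel.
have e0 : arr_tgt A Cel (tv (arr_from_cell (lp J Cel x)) (arr_to_cell (lp J Cel x)))
    = lp J Cel (tv (id2 (src2 x)) x).
  by rewrite arr_from_to_cell arr_tgt_unit tv_idl.
by rewrite (lam_tv _ _ e0) ?tgt2_id2 //; apply: lam_arr_unit;
  rewrite ?arr_from_to_cell ?tv_idl.
Qed.

Lemma rho_cel_tv {x : J Cel} {s : J Mor} {y : B Cel} e e' :
  s = tgt2 x -> y = rq J Cel x ->
  tv (rho J Cel (Pb x (arr_from_cell y) e')) (@rho_cel A B J y s e) = x.
Proof.
move=> hs hy; subst; rewrite /rho_cel.
have e0 : rq J Cel (tv x (id2 (tgt2 x)))
    = arr_src B Cel (tv (arr_from_cell (rq J Cel x)) (arr_to_cell (rq J Cel x))).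
  by rewrite arr_from_to_cell arr_src_unit tv_idr.
by rewrite (rho_tv _ _ e0) ?src2_id2 //; apply: rho_arr_unit;
  rewrite ?arr_from_to_cell ?tv_idr.
Qed.

(** Acting on a cleavage morphism by (id, id_u, u) undoes it.  This is what turns
  (iem) into an instance of inner equivariance, and what makes cleavage
  morphisms cancellable. *)
Lemma lam_from_to_id {u : A Mor} {i : J Ob} e e' :
  lam J Mor (Pb (arr_from_id u) (@lam_mor A B J u i e) e')
  = id1 (lam J Ob (Pb u i e)).
Proof.
have e0 : arr_tgt A Mor (arr_from_id u) = arr_src A Mor (arr_to_id u) by [].
have e1 : arr_tgt A Mor (arr_mul A Mor (Pb _ _ e0))
    = lp J Mor (id1 i) by rewrite arr_tgt_mul; exact: lam_mor_pf.
rewrite /lam_mor -(lam_mul e1) -f_id1.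
by apply: lam_eq => //; exact: arr_mul_from_to_id.
Qed.

Lemma rho_to_from_id {i : J Ob} {v : B Mor} e e' :
  rho J Mor (Pb (@rho_mor A B J i v e) (arr_to_id v) e')
  = id1 (rho J Ob (Pb i v e)).
Proof.
have e0 : arr_tgt B Mor (arr_from_id v) = arr_src B Mor (arr_to_id v) by [].
have e1 : rq J Mor (id1 i)
    = arr_src B Mor (arr_mul B Mor (Pb _ _ e0)).
  by rewrite arr_src_mul; exact: rho_mor_pf.
rewrite /rho_mor -(rho_mul e1) -f_id1.
by apply: rho_eq => //; exact: arr_mul_from_to_id.
Qed.

(** A left inverse, depending only on the [p]-component of [m], to composition
  with a cleavage morphism. *)
Lemma lam_mor_factor {m : J Mor} {u : A Mor} {i : J Ob} e e' :
  tgt1 m = lam J Ob (Pb u i e) ->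
  lam J Mor (Pb (tc (arr_from_id u) (arr_unit A Mor (lp J Mor m)))
               (tc (@lam_mor A B J u i e) m) e') = m.
Proof.
move=> hm; have e1 : arr_tgt A Mor (arr_from_id u) = lp J Mor (lam_mor e).
  by rewrite lp_lam_mor.
have e2 : arr_tgt A Mor (arr_unit A Mor (lp J Mor m)) = lp J Mor m.
  exact: arr_tgt_unit.
rewrite -(lam_tc e1 e2).
- by rewrite /= -f_tgt1 hm lp_lam.
- by rewrite src1_lam_mor hm.
- by rewrite lam_from_to_id lam_unit tc_idl.
Qed.

Lemma rho_mor_factor {m : J Mor} {i : J Ob} {v : B Mor} e e' :
  src1 m = rho J Ob (Pb i v e) ->
  rho J Mor (Pb (tc m (@rho_mor A B J i v e))
               (tc (arr_unit B Mor (rq J Mor m)) (arr_to_id v)) e') = m.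
Proof.
move=> hm; have e1 : rq J Mor (rho_mor e) = arr_src B Mor (arr_to_id v).
  by rewrite rq_rho_mor.
have e2 : rq J Mor m = arr_src B Mor (arr_unit B Mor (rq J Mor m)).
  by rewrite arr_src_unit.
rewrite -(rho_tc e2 e1).
- by rewrite hm tgt1_rho_mor.
- by rewrite /= -f_src1 hm rq_rho.
- by rewrite rho_to_from_id rho_unit tc_idr.
Qed.

Lemma lam_mor_inj {m m' : J Mor} {u : A Mor} {i : J Ob} e :
  tgt1 m = lam J Ob (Pb u i e) -> tgt1 m' = lam J Ob (Pb u i e) ->
  lp J Mor m = lp J Mor m' ->
  tc (@lam_mor A B J u i e) m = tc (@lam_mor A B J u i e) m' -> m = m'.
Proof.
move=> hm hm' hp h.
have e' : arr_tgt A Mor (tc (arr_from_id u) (arr_unit A Mor (lp J Mor m)))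
    = lp J Mor (tc (lam_mor e) m).
  have hu : src1 (arr_from_id u) = tgt1 (arr_unit A Mor (lp J Mor m)).
    by rewrite /= -f_tgt1 hm lp_lam.
  have hi : src1 (lam_mor e) = tgt1 m by rewrite src1_lam_mor.
  by rewrite (f_tc _ hu) (f_tc _ hi) lp_lam_mor arr_tgt_unit.
have e'' := e'; rewrite hp h in e''.
rewrite -[LHS](lam_mor_factor e e' hm) -[RHS](lam_mor_factor e e'' hm').
by apply: lam_eq; rewrite ?hp.
Qed.

Lemma rho_mor_inj {m m' : J Mor} {i : J Ob} {v : B Mor} e :
  src1 m = rho J Ob (Pb i v e) -> src1 m' = rho J Ob (Pb i v e) ->
  rq J Mor m = rq J Mor m' ->
  tc m (@rho_mor A B J i v e) = tc m' (@rho_mor A B J i v e) -> m = m'.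
Proof.
move=> hm hm' hq h.
have e' : rq J Mor (tc m (rho_mor e))
    = arr_src B Mor (tc (arr_unit B Mor (rq J Mor m)) (arr_to_id v)).
  have hv : src1 (arr_unit B Mor (rq J Mor m)) = tgt1 (arr_to_id v).
    by rewrite /= -f_src1 hm rq_rho.
  have hi : src1 m = tgt1 (rho_mor e) by rewrite tgt1_rho_mor.
  by rewrite (f_tc _ hv) (f_tc _ hi) rq_rho_mor arr_src_unit.
have e'' := e'; rewrite hq h in e''.
rewrite -[LHS](rho_mor_factor e e' hm) -[RHS](rho_mor_factor e e'' hm').
by apply: rho_eq; rewrite ?hq.
Qed.

Lemma tc_lam_mor {s : J Mor} {t u : A Mor} e e' :
  t = lp J Mor s ->
  tc s (@lam_mor A B J u (src1 s) e)
  = lam J Mor (Pb (tc (arr_unit A Mor t) (arr_to_id u)) s e').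
Proof.
move=> ht; subst.
have e1 := arr_tgt_unit (lp J Mor s).
have e2 : lp J Mor s = lp J Mor (tc s (id1 (src1 s))) by rewrite tc_idr.
transitivity (tc (lam J Mor (Pb _ s e1)) (lam_mor e)); first by rewrite lam_unit.
rewrite /lam_mor (lam_tc _ _ (eq_trans e' e2)) ?tgt1_id1 //.
  by rewrite /= -f_src1 e.
by apply: lam_eq; rewrite ?tc_idr.
Qed.

Lemma rho_mor_tc {s : J Mor} {t v : B Mor} e e' :
  t = rq J Mor s ->
  tc (@rho_mor A B J (tgt1 s) v e) s
  = rho J Mor (Pb s (tc (arr_from_id v) (arr_unit B Mor t)) e').
Proof.
move=> ht; subst.
have e1 := eq_sym (arr_src_unit (rq J Mor s)).
have e2 : rq J Mor (tc (id1 (tgt1 s)) s) = rq J Mor s by rewrite tc_idl.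
transitivity (tc (rho_mor e) (rho J Mor (Pb s _ e1))); first by rewrite rho_unit.
rewrite /rho_mor (rho_tc _ _ (eq_trans e2 e')) ?src1_id1 //.
  by rewrite /= -f_tgt1 e.
by apply: rho_eq; rewrite ?tc_idl.
Qed.

Lemma lam_mor_tc {x : arrow A Mor} {s : J Mor} e e1 e' :
  tc (@lam_mor A B J (am_cod x) (tgt1 s) e1) (lam J Mor (Pb x s e))
  = lam J Mor (Pb (tc (arr_to_id (am_cod x)) x) s e').
Proof.
have e2 : lp J Mor s = lp J Mor (tc (id1 (tgt1 s)) s) by rewrite tc_idl.
rewrite /lam_mor (lam_tc _ _ (eq_trans e' e2)) ?src1_id1 //.
by apply: lam_eq; rewrite ?tc_idl.
Qed.

Lemma tc_rho_mor {s : J Mor} {y : arrow B Mor} e e0 e' :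
  tc (rho J Mor (Pb s y e)) (@rho_mor A B J (src1 s) (am_dom y) e0)
  = rho J Mor (Pb s (tc y (arr_from_id (am_dom y))) e').
Proof.
have e2 : rq J Mor (tc s (id1 (src1 s))) = rq J Mor s by rewrite tc_idr.
rewrite /rho_mor (rho_tc _ _ (eq_trans e2 e')) ?tgt1_id1 //.
by apply: rho_eq; rewrite ?tc_idr.
Qed.

(** The defining property of [lambda] on a square [x] filled by
  [zeta : t u0 => u1 s]: the cleavage cell over [zeta] goes from [j] after the
  cleavage morphism at [u0] to the cleavage morphism at [u1] after
  [lambda(x, j)]. *)
Lemma tgt2_lam_cel {x : arrow A Mor} {s : J Mor} e e0 e1 ec :
  tgt2 (@lam_cel A B J (tc s (@lam_mor A B J (am_dom x) (src1 s) e0))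
          (am_cell x) ec)
  = tc (@lam_mor A B J (am_cod x) (tgt1 s) e1) (lam J Mor (Pb x s e)).
Proof.
have ht : arr_tgt A Mor (tc (arr_unit A Mor (am_tgt x)) (arr_to_id (am_dom x)))
    = lp J Mor s.
  by rewrite f_tc /= ?am_tgt_src // tc_idr ?am_tgt_src.
have hx : arr_tgt A Mor (arr_of_cell (am_cell x))
    = arr_src A Mor (tc (arr_unit A Mor (am_tgt x)) (arr_to_id (am_dom x))).
  by rewrite f_tc /= ?am_tgt_src // am_cell_srcE.
have hc : arr_tgt A Mor (arr_mul A Mor (Pb _ _ hx)) = lp J Mor s.
  by rewrite arr_tgt_mul.
have hc' : arr_tgt A Mor (tc (arr_to_id (am_cod x)) x) = lp J Mor s.
  by rewrite -(arr_mul_of_cell_to_id _ hx).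
rewrite (lam_mor_tc _ _ hc') /lam_cel -f_tgt2.
have hs := tc_lam_mor e0 ht e.
have h : arr_tgt A Mor (arr_of_cell (am_cell x)) = lp J Mor (lam J Mor (Pb _ _ ht)).
  by rewrite lp_lam.
transitivity (lam J Mor (Pb (arr_of_cell (am_cell x)) _ h)).
  by apply: lam_eq; rewrite /= ?tgt2_id2 ?hs.
rewrite -(lam_mul hc).
by apply: lam_eq => //; exact: arr_mul_of_cell_to_id.
Qed.

(** Dually, the cleavage cell over the filler of [y] goes from [rho(s, y)] after
  the cleavage morphism at [am_dom y] to the cleavage morphism at [am_cod y]
  after [s]. *)
Lemma src2_rho_cel {s : J Mor} {y : arrow B Mor} e e0 e1 ec :
  src2 (@rho_cel A B J (am_cell y)
          (tc (@rho_mor A B J (tgt1 s) (am_cod y) e1) s) ec)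
  = tc (rho J Mor (Pb s y e)) (@rho_mor A B J (src1 s) (am_dom y) e0).
Proof.
have hs : rq J Mor s
    = arr_src B Mor (tc (arr_from_id (am_cod y)) (arr_unit B Mor (am_src y))).
  by rewrite f_tc /= ?am_src_tgt // tc_idl ?am_src_tgt.
have hy : arr_tgt B Mor (tc (arr_from_id (am_cod y)) (arr_unit B Mor (am_src y)))
    = arr_src B Mor (arr_of_cell (am_cell y)).
  by rewrite f_tc /= ?am_src_tgt // am_cell_tgtE.
have hc : rq J Mor s = arr_src B Mor (arr_mul B Mor (Pb _ _ hy)).
  by rewrite arr_src_mul.
have hc' : rq J Mor s = arr_src B Mor (tc y (arr_from_id (am_dom y))).
  by rewrite -(arr_mul_from_id_of_cell _ hy).
rewrite (tc_rho_mor _ _ hc') /rho_cel -f_src2.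
have hr := rho_mor_tc e1 hs (eq_sym e).
have h : rq J Mor (rho J Mor (Pb _ _ hs)) = arr_src B Mor (arr_of_cell (am_cell y)).
  by rewrite rq_rho.
transitivity (rho J Mor (Pb _ (arr_of_cell (am_cell y)) h)).
  by apply: rho_eq; rewrite /= ?src2_id2 ?hr.
rewrite -(rho_mul hc).
by apply: rho_eq => //; exact: arr_mul_from_id_of_cell.
Qed.

End Actions.

(** * Locally discrete split two-sided 2-fibrations *)

Section LocallyDiscrete.
Context {C D : twocat} {K : s2fib C D} (hK : locally_discrete K).

(** The comparison with the cleavage cell lies over identities on both sides. *)
Lemma ld_lam_cel {x : K Cel} {s : K Mor} {y : C Cel} e :
  src2 x = s -> lp K Cel x = y -> is_id2 (rq K Cel x) ->
  x = @lam_cel C D K s y e.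
Proof.
move=> hs hy hq; have e' : arr_tgt C Cel (arr_to_cell y) = lp K Cel x by rewrite hy.
have [r hr] : is_id2 (lam K Cel (Pb (arr_to_cell y) x e')).
  by apply: hK; rewrite ?rq_lam // lp_lam; exists (tgt2 y).
have hr2 : src2 (lam K Cel (Pb (arr_to_cell y) x e')) = tgt2 (lam_cel e).
  by rewrite /lam_cel -f_src2 -f_tgt2; apply: lam_eq; rewrite /= ?tgt2_id2.
rewrite -[LHS](lam_cel_tv e e') // hr tv_idr //.
by rewrite -hr2 hr src2_id2.
Qed.

Lemma ld_rho_cel {x : K Cel} {s : K Mor} {y : D Cel} e :
  tgt2 x = s -> rq K Cel x = y -> is_id2 (lp K Cel x) ->
  x = @rho_cel C D K y s e.
Proof.
move=> hs hy hp; have e' : rq K Cel x = arr_src D Cel (arr_from_cell y) by rewrite hy.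
have [r hr] : is_id2 (rho K Cel (Pb x (arr_from_cell y) e')).
  by apply: hK; rewrite ?lp_rho // rq_rho; exists (src2 y).
have hr2 : tgt2 (rho K Cel (Pb x (arr_from_cell y) e')) = src2 (rho_cel e).
  by rewrite /rho_cel -f_src2 -f_tgt2; apply: rho_eq; rewrite /= ?src2_id2.
rewrite -[LHS](rho_cel_tv e e') // hr tv_idl //.
by rewrite -hr2 hr tgt2_id2.
Qed.

(** Factor off the cleavage cell over the [p]-component: the rest lies over an
  identity on that side, so [ld_rho_cel] determines it from its target and its
  [q]-component. *)
Lemma ld_cel_eq {x x' : K Cel} :
  src2 x = src2 x' -> tgt2 x = tgt2 x' -> lp K Cel x = lp K Cel x' ->
  rq K Cel x = rq K Cel x' -> x = x'.
Proof.
move=> hs ht hp hq.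
have e : lp K Mor (src2 x) = src2 (lp K Cel x) by rewrite f_src2.
have e1 : arr_tgt C Cel (arr_to_cell (lp K Cel x)) = lp K Cel x by [].
have e1' : arr_tgt C Cel (arr_to_cell (lp K Cel x)) = lp K Cel x' by [].
have e2 : tgt2 (rq K Cel x) = rq K Mor (tgt2 x) by rewrite f_tgt2.
rewrite -(lam_cel_tv e e1) // -[RHS](lam_cel_tv e e1') //; congr (tv _ _).
transitivity (rho_cel e2); [|symmetry]; apply: ld_rho_cel;
  rewrite ?rq_lam // ?lp_lam; try by exists (tgt2 (lp K Cel x)).
- by rewrite -f_tgt2; apply: lam_arr_unit; rewrite //= -f_tgt2.
- by rewrite -f_tgt2; apply: lam_arr_unit; rewrite //= -f_tgt2.
Qed.

End LocallyDiscrete.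

(** * The conditions on cells *)

Section Cells.
Context {A0 An C D : twocat} {J : path A0 An} {K : s2fib C D}.
Context {f : functor A0 C} {g : functor An D} (phi : functor_over J K f g).
Hypothesis hK : locally_discrete K.

Lemma ld_poc : poc phi.
Proof.
move=> s x e; apply: ld_lam_cel => //.
- by rewrite -f_src2 src2_lam_cel.
- by rewrite fo_lp lp_lam_cel.
- by rewrite fo_rq rq_lam_cel f_id2; eexists.
Qed.

Lemma ld_pcc : pcc phi.
Proof.
move=> s x e; apply: ld_rho_cel => //.
- by rewrite -f_tgt2 tgt2_rho_cel.
- by rewrite fo_rq rq_rho_cel.
- by rewrite fo_lp lp_rho_cel f_id2; eexists.
Qed.

Lemma ld_iec : iec phi.
Proof.
move=> B P1 P2 c s x t es et; apply: hK.
- by rewrite fo_lp lp_glue lp_rho_cel f_id2; eexists.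
- by rewrite fo_rq rq_glue rq_lam_cel f_id2; eexists.
Qed.

End Cells.

(** * Outer equivariance *)

Section Outer.
Context {A0 An C D : twocat} {J : path A0 An} {K : s2fib C D}.
Context {f : functor A0 C} {g : functor An D} (phi : functor_over J K f g).

Lemma lam_equivariant_pcm : lam_equivariant phi -> pcm phi.
Proof.
move=> h i u e; rewrite /lam_mor h; apply: lam_eq.
- exact: arr_map_to_id.
- exact: f_id1.
Qed.

Lemma rho_equivariant_pom : rho_equivariant phi -> pom phi.
Proof.
move=> h i v e; rewrite /rho_mor h; apply: rho_eq.
- exact: f_id1.
- exact: arr_map_from_id.
Qed.

Lemma pcm_lam_ob : pcm phi -> forall u i (e : arr_tgt A0 Ob u = lp (iprod J) Ob i)
    u' i' e', u' = f Mor u -> i' = phi Ob i ->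
  phi Ob (lam (iprod J) Ob (Pb u i e)) = lam K Ob (Pb u' i' e').
Proof.
move=> h u i e u' i' e' hu hi; subst; have := f_equal (@src1 _) (h i u e).
by rewrite -f_src1 !src1_lam_mor => ->; apply: lam_eq.
Qed.

Lemma pom_rho_ob : pom phi -> forall i v (e : rq (iprod J) Ob i = arr_src An Ob v)
    i' v' e', i' = phi Ob i -> v' = g Mor v ->
  phi Ob (rho (iprod J) Ob (Pb i v e)) = rho K Ob (Pb i' v' e').
Proof.
move=> h i v e i' v' e' hi hv; subst; have := f_equal (@tgt1 _) (h i v e).
by rewrite -f_tgt1 !tgt1_rho_mor => ->; apply: rho_eq.
Qed.

(** Both sides lie over the same morphism, and by [tgt2_lam_cel] their composites
  with the cleavage morphism at [am_cod x] are the target of the same cleavage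
  cell, since (poc) and (pcm) let [phi] pass through its construction. *)
Lemma pcm_lam_mor : poc phi -> pcm phi ->
  forall (x : arrow A0 Mor) s (e : arr_tgt A0 Mor x = lp (iprod J) Mor s) e',
  phi Mor (lam (iprod J) Mor (Pb x s e))
  = lam K Mor (Pb (arr_map f Mor x) (phi Mor s) e').
Proof.
move=> hc hm x s e e'.
have e0 : tgt1 (am_dom x) = lp (iprod J) Ob (src1 s).
  by rewrite f_src1 -e /= am_tgt_src.
have e1 : tgt1 (am_cod x) = lp (iprod J) Ob (tgt1 s).
  by rewrite f_tgt1 -e /= am_tgt_tgt.
have hs : src1 s = tgt1 (lam_mor e0) by rewrite tgt1_lam_mor.
have ec : lp (iprod J) Mor (tc s (lam_mor e0)) = src2 (am_cell x).
  by rewrite (f_tc _ hs) lp_lam_mor -e am_cell_srcE.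
have hl : src1 (lam_mor e1) = tgt1 (lam (iprod J) Mor (Pb x s e)).
  by rewrite src1_lam_mor -f_tgt1; apply: lam_eq.
have h1 : tgt1 (f Mor (am_cod x)) = lp K Ob (tgt1 (phi Mor s)).
  by rewrite -!f_tgt1 fo_lp e1.
have h0 : tgt1 (f Mor (am_dom x)) = lp K Ob (src1 (phi Mor s)).
  by rewrite -f_tgt1 -f_src1 fo_lp e0.
have hc' : lp K Mor (tc (phi Mor s) (lam_mor h0)) = src2 (am_cell (arr_map f Mor x)).
  rewrite f_tc ?tgt1_lam_mor // lp_lam_mor -e' /=.
  by rewrite (am_cell_srcE (arr_map f Mor x)).
apply: (lam_mor_inj h1).
- transitivity (phi Ob (lam (iprod J) Ob (Pb (am_cod x) (tgt1 s) e1))).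
    by rewrite -!f_tgt1; congr (fmap _ _ _); apply: lam_eq.
  by apply: pcm_lam_ob => //; rewrite f_tgt1.
- by rewrite -f_tgt1; apply: lam_eq.
- by rewrite fo_lp !lp_lam; symmetry; exact: arr_src_map.
- rewrite -(tgt2_lam_cel e' h0 h1 hc').
  have <- : lam_cel (poc_pf phi ec) = lam_cel hc'.
    apply: lam_cel_eq => //; rewrite (f_tc _ hs) hm.
    by congr (tc _ _); apply: lam_mor_eq; rewrite ?f_src1.
  rewrite -hc -f_tgt2 (tgt2_lam_cel e e0 e1) (f_tc _ hl) hm.
  by congr (tc _ _); apply: lam_mor_eq; rewrite ?f_tgt1.
Qed.

Lemma pom_rho_mor : pcc phi -> pom phi ->
  forall s (y : arrow An Mor) (e : rq (iprod J) Mor s = arr_src An Mor y) e',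
  phi Mor (rho (iprod J) Mor (Pb s y e))
  = rho K Mor (Pb (phi Mor s) (arr_map g Mor y) e').
Proof.
move=> hc hm s y e e'.
have e0 : rq (iprod J) Ob (src1 s) = src1 (am_dom y).
  by rewrite f_src1 e /= am_src_src.
have e1 : rq (iprod J) Ob (tgt1 s) = src1 (am_cod y).
  by rewrite f_tgt1 e /= am_src_tgt.
have hs : src1 (rho_mor e1) = tgt1 s by rewrite src1_rho_mor.
have ec : tgt2 (am_cell y) = rq (iprod J) Mor (tc (rho_mor e1) s).
  by rewrite (f_tc _ hs) rq_rho_mor e am_cell_tgtE.
have hr : src1 (rho (iprod J) Mor (Pb s y e)) = tgt1 (rho_mor e0).
  by rewrite tgt1_rho_mor -f_src1; apply: rho_eq.
have h1 : rq K Ob (tgt1 (phi Mor s)) = src1 (g Mor (am_cod y)).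
  by rewrite -f_tgt1 -f_src1 fo_rq e1.
have h0 : rq K Ob (src1 (phi Mor s)) = src1 (g Mor (am_dom y)).
  by rewrite -!f_src1 fo_rq e0.
have hc' : tgt2 (am_cell (arr_map g Mor y)) = rq K Mor (tc (rho_mor h1) (phi Mor s)).
  rewrite f_tc ?src1_rho_mor // rq_rho_mor e' /=.
  by rewrite (am_cell_tgtE (arr_map g Mor y)).
apply: (rho_mor_inj h0).
- transitivity (phi Ob (rho (iprod J) Ob (Pb (src1 s) (am_dom y) e0))).
    by rewrite -!f_src1; congr (fmap _ _ _); apply: rho_eq.
  by apply: pom_rho_ob => //; rewrite f_src1.
- by rewrite -f_src1; apply: rho_eq.
- by rewrite fo_rq !rq_rho; symmetry; exact: arr_tgt_map.
- rewrite -(src2_rho_cel e' h0 h1 hc').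
  have <- : rho_cel (pcc_pf phi ec) = rho_cel hc'.
    apply: rho_cel_eq => //; rewrite (f_tc _ hs) hm.
    by congr (tc _ _); apply: rho_mor_eq; rewrite ?f_tgt1.
  rewrite -hc -f_src2 (src2_rho_cel e e0 e1) (f_tc _ hr) hm.
  by congr (tc _ _); apply: rho_mor_eq; rewrite ?f_src1.
Qed.

Lemma pcm_lam_equivariant (hK : locally_discrete K) : pcm phi -> lam_equivariant phi.
Proof.
move=> hm [|  |] x i e.
- exact: pcm_lam_ob.
- by apply: pcm_lam_mor; first exact: ld_poc.
- have hc := ld_poc phi hK; apply: ld_cel_eq => //.
  + have e1 : arr_tgt A0 Mor (ac_dom x) = lp (iprod J) Mor (src2 i).
      by rewrite f_src2 -e /= ac_tgt_src.
    transitivity (phi Mor (lam (iprod J) Mor (Pb _ _ e1))).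
      by rewrite -!f_src2; congr (fmap _ _ _); apply: lam_eq.
    rewrite (pcm_lam_mor hc hm _ _ e1 (outer_lam_pf phi e1)) -f_src2.
    by apply: lam_eq; rewrite ?f_src2.
  + have e1 : arr_tgt A0 Mor (ac_cod x) = lp (iprod J) Mor (tgt2 i).
      by rewrite f_tgt2 -e /= ac_tgt_tgt.
    transitivity (phi Mor (lam (iprod J) Mor (Pb _ _ e1))).
      by rewrite -!f_tgt2; congr (fmap _ _ _); apply: lam_eq.
    rewrite (pcm_lam_mor hc hm _ _ e1 (outer_lam_pf phi e1)) -f_tgt2.
    by apply: lam_eq; rewrite ?f_tgt2.
  + by rewrite fo_lp !lp_lam.
  + by rewrite fo_rq !rq_lam fo_rq.
Qed.

Lemma pom_rho_equivariant (hK : locally_discrete K) : pom phi -> rho_equivariant phi.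
Proof.
move=> hm [|  |] i y e.
- exact: pom_rho_ob.
- by apply: pom_rho_mor; first exact: ld_pcc.
- have hc := ld_pcc phi hK; apply: ld_cel_eq => //.
  + have e1 : rq (iprod J) Mor (src2 i) = arr_src An Mor (ac_dom y).
      by rewrite f_src2 e /= ac_src_src.
    transitivity (phi Mor (rho (iprod J) Mor (Pb _ _ e1))).
      by rewrite -!f_src2; congr (fmap _ _ _); apply: rho_eq.
    rewrite (pom_rho_mor hc hm _ _ e1 (outer_rho_pf phi e1)) -f_src2.
    by apply: rho_eq; rewrite ?f_src2.
  + have e1 : rq (iprod J) Mor (tgt2 i) = arr_src An Mor (ac_cod y).
      by rewrite f_tgt2 e /= ac_src_tgt.
    transitivity (phi Mor (rho (iprod J) Mor (Pb _ _ e1))).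
      by rewrite -!f_tgt2; congr (fmap _ _ _); apply: rho_eq.
    rewrite (pom_rho_mor hc hm _ _ e1 (outer_rho_pf phi e1)) -f_tgt2.
    by apply: rho_eq; rewrite ?f_tgt2.
  + by rewrite fo_lp !lp_rho fo_lp.
  + by rewrite fo_rq !rq_rho.
Qed.

End Outer.

(** * Inner equivariance *)

Lemma glue_eq {A B C : twocat} {P1 : path A B} {P2 : path B C} {P : path A C}
  (c : cut P1 P2 P) {d} {i i' : iprod P1 d} {j j' : iprod P2 d} e e' :
  i = i' -> j = j' -> glue c d i j e = glue c d i' j' e'.
Proof. by move=> hi hj; subst; rewrite (proof_irrelevance _ e e'). Qed.

Definition identity_functor (X : twocat) : functor X X.
Proof.
by refine {| fmap := fun d (x : X d) => x |}; intros;
   first [exact: comp_eq | exact: hcomp_eq | exact: vcomp_eq | idtac].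
Defined.

(** Precomposing with gluing reduces inner equivariance to the case of two
  factors. *)
Lemma glue_functor {A B C : twocat} {P1 : path A B} {P2 : path B C}
  {P : path A C} (c : cut P1 P2 P) :
  exists G : functor (pullback (rq (iprod P1)) (lp (iprod P2))) (iprod P),
  forall d i j e, G d (Pb i j e) = glue c d i j e.
Proof.
elim: c => [A0 B0 C0 J Q|A0 A1 B0 C0 J Q1 Q2 Q c [G hG]].
  by exists (identity_functor _).
pose Q12 := pullback (rq (iprod (pcons J Q1))) (lp (iprod Q2)).
pose fst1 : functor Q12 (iprod (pcons J Q1)) := pr1 _ _.
pose snd1 : functor Q12 (iprod Q2) := pr2 _ _.
pose T : functor Q12 _ := pairing
  (F := fcompose (pr2 (rq J) (lp (iprod Q1))) fst1) (G := snd1) (fun d z => pbE z).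
have hT d (z : Q12 d) :
    rq J d (fcompose (pr1 (rq J) (lp (iprod Q1))) fst1 d z)
    = lp (iprod Q) d (fcompose G T d z).
  by rewrite /= hG lp_glue; exact: pbE.
exists (pairing hT) => d i j e; rewrite /glue /=.
apply: pb_eq; rewrite /= ?hG /glue; by case: glue_sig.
Qed.

Lemma functor_tc_id {Y X : twocat} (F : functor Y X) {t s : Y Mor} :
  is_id1 (F Mor s) -> src1 t = tgt1 s -> F Mor (tc t s) = F Mor t.
Proof.
move=> [a ha] h; rewrite f_tc // ha tc_idr //.
by rewrite -f_src1 h f_tgt1 ha tgt1_id1.
Qed.

Lemma functor_id_tc {Y X : twocat} (F : functor Y X) {t s : Y Mor} :
  is_id1 (F Mor t) -> src1 t = tgt1 s -> F Mor (tc t s) = F Mor s.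
Proof.
move=> [a ha] h; rewrite f_tc // ha tc_idl //.
by rewrite -f_tgt1 -h f_src1 ha src1_id1.
Qed.

Lemma functor_cell_id {Y X : twocat} (F : functor Y X) {x : Y Cel} :
  is_id2 (F Cel x) -> F Mor (src2 x) = F Mor (tgt2 x).
Proof. by move=> [s hs]; rewrite f_src2 f_tgt2 hs src2_id2 tgt2_id2. Qed.

Section Inner.
Context {A B C X : twocat} {E1 : s2fib A B} {E2 : s2fib B C}.
Context (Phi : functor (pullback (rq E1) (lp E2)) X).

(** The pair of cleavage morphisms over [u] has the two tuples to be compared as
  its target and source. *)
Lemma balanced_ob (i : E1 Ob) (u : B Mor) (j : E2 Ob) er el em e e' :
  is_id1 (Phi Mor (Pb (@rho_mor A B E1 i u er) (@lam_mor B C E2 u j el) em)) ->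
  Phi Ob (Pb (rho E1 Ob (Pb i u er)) j e) = Phi Ob (Pb i (lam E2 Ob (Pb u j el)) e').
Proof.
move=> [a ha].
transitivity (Phi Ob (tgt1 (Pb (rho_mor er) (lam_mor el) em : pullback _ _ Mor))).
  congr (fmap _ _ _); apply: pb_eq => /=; first by rewrite tgt1_rho_mor.
  by rewrite tgt1_lam_mor.
transitivity (Phi Ob (src1 (Pb (rho_mor er) (lam_mor el) em : pullback _ _ Mor))).
  by rewrite f_tgt1 f_src1 ha src1_id1 tgt1_id1.
congr (fmap _ _ _); apply: pb_eq => /=; first by rewrite src1_rho_mor.
by rewrite src1_lam_mor.
Qed.

(** The two tuples differ by composition with pairs of cleavage morphisms, whose
  images are identities by [hm], and by the pair of cleavage cells over the
  filler of [y], whose image is an identity by [hc]. *)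
Lemma balanced_mor
  (hm : forall i u j er el em,
    is_id1 (Phi Mor (Pb (@rho_mor A B E1 i u er) (@lam_mor B C E2 u j el) em)))
  (hc : forall s x t er el em,
    is_id2 (Phi Cel (Pb (@rho_cel A B E1 x s er) (@lam_cel B C E2 t x el) em)))
  (s : E1 Mor) (y : arrow B Mor) (t : E2 Mor) er el e e' :
  Phi Mor (Pb (rho E1 Mor (Pb s y er)) t e)
  = Phi Mor (Pb s (lam E2 Mor (Pb y t el)) e').
Proof.
have r0 : rq E1 Ob (src1 s) = src1 (am_dom y) by rewrite f_src1 er /= am_src_src.
have r1 : rq E1 Ob (tgt1 s) = src1 (am_cod y) by rewrite f_tgt1 er /= am_src_tgt.
have l0 : tgt1 (am_dom y) = lp E2 Ob (src1 t) by rewrite f_src1 -el /= am_tgt_src.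
have l1 : tgt1 (am_cod y) = lp E2 Ob (tgt1 t) by rewrite f_tgt1 -el /= am_tgt_tgt.
have w0 : rq E1 Mor (rho_mor r0) = lp E2 Mor (lam_mor l0).
  by rewrite rq_rho_mor lp_lam_mor.
have w1 : rq E1 Mor (rho_mor r1) = lp E2 Mor (lam_mor l1).
  by rewrite rq_rho_mor lp_lam_mor.
have hr0 : src1 (rho E1 Mor (Pb s y er)) = tgt1 (rho_mor r0).
  by rewrite tgt1_rho_mor -f_src1; apply: rho_eq.
have hl0 : src1 t = tgt1 (lam_mor l0) by rewrite tgt1_lam_mor.
have hr1 : src1 (rho_mor r1) = tgt1 s by rewrite src1_rho_mor.
have hl1 : src1 (lam_mor l1) = tgt1 (lam E2 Mor (Pb y t el)).
  by rewrite src1_lam_mor -f_tgt1; apply: lam_eq.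
have cr : tgt2 (am_cell y) = rq E1 Mor (tc (rho_mor r1) s).
  by rewrite (f_tc _ hr1) rq_rho_mor er am_cell_tgtE.
have cl : lp E2 Mor (tc t (lam_mor l0)) = src2 (am_cell y).
  by rewrite (f_tc _ hl0) lp_lam_mor -el am_cell_srcE.
have cm : rq E1 Cel (rho_cel cr) = lp E2 Cel (lam_cel cl).
  by rewrite rq_rho_cel lp_lam_cel.
have q0 : rq E1 Mor (tc (rho E1 Mor (Pb s y er)) (rho_mor r0))
    = lp E2 Mor (tc t (lam_mor l0)).
  by rewrite (f_tc _ hr0) (f_tc _ hl0) e w0.
have q1 : rq E1 Mor (tc (rho_mor r1) s)
    = lp E2 Mor (tc (lam_mor l1) (lam E2 Mor (Pb y t el))).
  by rewrite (f_tc _ hr1) (f_tc _ hl1) e' w1.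
have hL : @src1 (pullback (rq E1) (lp E2)) (Pb _ t e)
    = tgt1 (Pb _ _ w0 : pullback (rq E1) (lp E2) Mor) by exact: pb_eq.
have hR : @src1 (pullback (rq E1) (lp E2)) (Pb _ _ w1)
    = tgt1 (Pb s _ e' : pullback (rq E1) (lp E2) Mor) by exact: pb_eq.
(* Insert on either side the image of a pair of cleavage morphisms. *)
rewrite -[LHS](functor_tc_id Phi (hm _ _ _ _ _ w0) hL).
rewrite -[RHS](functor_id_tc Phi (hm _ _ _ _ _ w1) hR).
rewrite (tc_pb _ _ q0) // (tc_pb _ _ q1) //.
transitivity (Phi Mor (src2 (Pb _ _ cm : pullback _ _ Cel))).
  congr (fmap _ _ _); apply: pb_eq => /=; last by rewrite src2_lam_cel.
  by rewrite (src2_rho_cel er r0 r1 cr).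
rewrite (functor_cell_id Phi (hc _ _ _ _ _ cm)).
congr (fmap _ _ _); apply: pb_eq => /=; first by rewrite tgt2_rho_cel.
by rewrite (tgt2_lam_cel el l0 l1 cl).
Qed.

End Inner.

Section InnerPath.
Context {A0 An C D : twocat} {J : path A0 An} {K : s2fib C D}.
Context {f : functor A0 C} {g : functor An D} (phi : functor_over J K f g).

(** Move the square (id, id_u, u) from [rho] on an identity to [lambda] on the
  cleavage morphism, which it undoes. *)
Lemma inner_equivariant_iem : inner_equivariant phi -> iem phi.
Proof.
move=> h B P1 P2 c i u j ei ej.
have ej' : arr_tgt B Mor (arr_from_id u) = lp (iprod P2) Mor (lam_mor ej).
  by rewrite lp_lam_mor.
have := h _ _ _ c Mor _ _ _ (rho_mor_pf ei) ej'.
rewrite (glue_eq c _ (iem_pf ei ej) eq_refl eq_refl) => ->.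
have [G hG] := glue_functor c.
have e0 : rq (iprod P1) Ob i = lp (iprod P2) Ob (lam (iprod P2) Ob (Pb u j ej)).
  by rewrite lp_lam.
rewrite -hG; exists (phi Ob (G Ob (Pb _ _ e0))); rewrite -!f_id1.
by congr (fmap _ _ (fmap _ _ _)); apply: pb_eq => //=; rewrite lam_from_to_id.
Qed.

(** On cells it suffices to compare boundaries, which is the case of morphisms, as
  both cells have the same components over the outer ends. *)
Lemma iem_inner_equivariant (hK : locally_discrete K) :
  iem phi -> inner_equivariant phi.
Proof.
move=> hm B P1 P2 c d i x j; have hc := ld_iec phi hK.
have [G hG] := glue_functor c.
pose Phi := fcompose phi G.
have hm' i' u j' er el em :
    is_id1 (Phi Mor
      (Pb (@rho_mor _ _ (iprod P1) i' u er) (@lam_mor _ _ (iprod P2) u j' el) em)).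
  by rewrite /Phi /= hG (glue_eq c em (iem_pf er el)).
have hc' s y t er el em :
    is_id2 (Phi Cel
      (Pb (@rho_cel _ _ (iprod P1) y s er) (@lam_cel _ _ (iprod P2) t y el) em)).
  by rewrite /Phi /= hG (glue_eq c em (iec_pf er el)).
case: d i x j => i x j ei ej; rewrite -!hG.
- exact: (balanced_ob Phi _ _ _ _ _ _ _ _ (hm' _ _ _ _ _ (iem_pf ei ej))).
- exact: (balanced_mor Phi hm' hc').
- apply: ld_cel_eq => //.
  + have er : rq (iprod P1) Mor (src2 i) = arr_src B Mor (ac_dom x).
      by rewrite f_src2 ei /= ac_src_src.
    have el : arr_tgt B Mor (ac_dom x) = lp (iprod P2) Mor (src2 j).
      by rewrite f_src2 -ej /= ac_tgt_src.
    rewrite -!f_src2.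
    transitivity (Phi Mor (Pb _ _ (inner_rho_pf er el))).
      by congr (fmap _ _ (fmap _ _ _)); apply: pb_eq => //=;
        rewrite -f_src2; apply: rho_eq.
    rewrite (balanced_mor Phi hm' hc' _ _ _ er el _ (inner_lam_pf er el)).
    by congr (fmap _ _ (fmap _ _ _)); apply: pb_eq => //=;
        rewrite -f_src2; apply: lam_eq.
  + have er : rq (iprod P1) Mor (tgt2 i) = arr_src B Mor (ac_cod x).
      by rewrite f_tgt2 ei /= ac_src_tgt.
    have el : arr_tgt B Mor (ac_cod x) = lp (iprod P2) Mor (tgt2 j).
      by rewrite f_tgt2 -ej /= ac_tgt_tgt.
    rewrite -!f_tgt2.
    transitivity (Phi Mor (Pb _ _ (inner_rho_pf er el))).
      by congr (fmap _ _ (fmap _ _ _)); apply: pb_eq => //=;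
        rewrite -f_tgt2; apply: rho_eq.
    rewrite (balanced_mor Phi hm' hc' _ _ _ er el _ (inner_lam_pf er el)).
    by congr (fmap _ _ (fmap _ _ _)); apply: pb_eq => //=;
        rewrite -f_tgt2; apply: lam_eq.
  + by rewrite !fo_lp !hG !lp_glue lp_rho.
  + by rewrite !fo_rq !hG !rq_glue rq_lam.
Qed.

Lemma is_unary_cell_iff (hK : locally_discrete K) :
  is_unary_cell phi <-> pcm phi /\ iem phi /\ pom phi.
Proof.
split=> [[hl [hr hi]]|[hl [hi hr]]]; (split; [|split]).
- exact: lam_equivariant_pcm.
- exact: inner_equivariant_iem.
- exact: rho_equivariant_pom.
- exact: pcm_lam_equivariant.
- exact: pom_rho_equivariant.
- exact: iem_inner_equivariant.
Qed.

End InnerPath.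

Theorem proposition7p10 (A0 An C D : twocat) (J : path A0 An)
  (K : s2fib C D) (hK : locally_discrete K)
  (f : functor A0 C) (g : functor An D) :
  (forall phi : functor_over J K f g, poc phi /\ iec phi /\ pcc phi) /\
  (forall phi : functor_over J K f g,
     is_unary_cell phi <-> pcm phi /\ iem phi /\ pom phi) /\
  (path_locally_discrete J ->
   forall phi : functor_over J K f g,
     is_unary_cell_ld phi <-> pcm phi /\ iem phi /\ pom phi).
Proof.
have H := @is_unary_cell_iff _ _ _ _ J K f g.
split; [|split].
- by move=> phi; split; [exact: ld_poc|split; [exact: ld_iec|exact: ld_pcc]].
- by move=> phi; exact: H.
- by move=> hJ phi; split=> [[_ [_ /(H phi hK)]]|/(H phi hK)].
Qed.
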